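(* Let $G=(V,E)$ be a finite simple connected unweighted graph with maximal vertex degree $D$, and let $0=\lambda_0<\lambda_1\le\lambda_2\le\dots$ be the eigenvalues (with multiplicity) of $-\Delta$, where $\Delta f(x)=\sum_{y\sim x}(f(y)-f(x))$. The following are equivalent: (1) $G$ is isomorphic to the $D$-dimensional hypercube $H_D$. (2) $G$ satisfies $CD(K,\infty)$ for some $K>0$ and $\lambda_D=K$. (3) $G$ satisfies $CD(K,\infty)$ for some $K>0$ and $\operatorname{diam}_d(G)=\frac{2D}{K}$.
   Context: For $f,g:V\to\mathbb R$: $2\Gamma(f,g)=\Delta(fg)-f\Delta g-g\Delta f$, $2\Gamma_2(f,g)=\Delta\Gamma(f,g)-\Gamma(f,\Delta g)-\Gamma(g,\Delta f)$, $\Gamma f=\Gamma(f,f)$, $\Gamma_2 f=\Gamma_2(f,f)$. $G$ satisfies $CD(K,\infty)$ if $\Gamma_2f(x)\ge K\Gamma f(x)$ for all $f$ and all $x\in V$. $\operatorname{diam}_d(G)$ is the maximum combinatorial (path-length) distance between vertices. $H_D$ is the graph with vertex set the power set of $\{1,\dots,D\}$, with $A\sim B$ iff their symmetric difference has exactly one element. *)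

(* Defs.v *)
(* Graphs: T : finType with a symmetric irreflexive e : rel T.
   Real scalars: an arbitrary real closed field R. *)
From HB Require Import structures.
From mathcomp Require Import all_boot all_order all_algebra.
Set Implicit Arguments. Unset Strict Implicit. Unset Printing Implicit Defensive.
Import Order.TTheory GRing.Theory Num.Theory.
Local Open Scope ring_scope.

Section Graph.
Variables (R : rcfType) (T : finType) (e : rel T).

Definition Lap (f : T -> R) : T -> R := fun x => \sum_(y | e x y) (f y - f x).

Definition Gam (f g : T -> R) : T -> R :=
  fun x => (Lap (fun z => f z * g z) x - f x * Lap g x - g x * Lap f x) / 2%:R.

Definition Gam2 (f g : T -> R) : T -> R :=
  fun x => (Lap (Gam f g) x - Gam f (Lap g) x - Gam g (Lap f) x) / 2%:R.

Definition CD (K : R) : Prop :=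
  forall (f : T -> R) (x : T), K * Gam f f x <= Gam2 f f x.

Definition negLapMx : 'M[R]_#|T| :=
  \matrix_(i, j)
    (if i == j then (#|[pred y | e (enum_val i) y]|)%:R
     else if e (enum_val i) (enum_val j) then -1 else 0).

Definition spectrum (s : seq R) : Prop :=
  sorted <=%R s /\ char_poly negLapMx = \prod_(x <- s) ('X - x%:P).

Definition eigval_eq (k : nat) (K : R) : Prop :=
  exists s, spectrum s /\ nth 0 s k = K.

End Graph.

Section Comb.
Variables (T : finType) (e : rel T).

Definition maxdeg : nat := (\max_(x : T) #|[pred y | e x y]|)%N.

Definition walk (n : nat) (x y : T) : bool :=
  [exists p : n.-tuple T, path e x p && (last x p == y)].

(* combinatorial distance (correct for connected graphs, where it is < #|T|) *)
Definition gdist (x y : T) : nat := find (fun n => walk n x y) (iota 0 #|T|).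

Definition diam : nat := (\max_(x : T) \max_(y : T) gdist x y)%N.

End Comb.

Definition hc_adj (D : nat) : rel {set 'I_D} :=
  fun A B => #|(A :\: B) :|: (B :\: A)| == 1%N.

Definition iso_hypercube (T : finType) (e : rel T) (D : nat) : Prop :=
  exists f : T -> {set 'I_D}, bijective f /\ forall x y, e x y = @hc_adj D (f x) (f y).

(* Main.v *)
(* If [CD K] holds and [Lap f = - K f], integrating [Gam2 f >= K Gam f] gives
   equality at every point. Hence [Gam f] is constant, and polarizing at the
   minimizer [f] yields a local rule: if [x <> z] are not adjacent, then
   [f x + f z - 2 f y] sums to [0] over their common neighbours [y].

   Suppose that [D] eigenfunctions [F i] for [K] have as their gradients at one
   vertex the standard basis. Then their gradients are orthonormal everywhere,
   so every vertex has degree [D]; the local rule shows that [x] and [z] at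
   distance two have exactly two common neighbours, which complete a square
   mapped by [F] to a parallelogram. Therefore each edge changes a single
   coordinate of [F], the coordinate flips are commuting involutions acting
   transitively, and the graph is the hypercube.

   If [lambda_D = K], Lichnerowicz' bound and the simplicity of [0] give [D]
   independent eigenfunctions for [K], which normalize to such a frame.

   If the diameter is [2 D / K], let [f] be the distance to an end [x0] of a
   diametral pair and solve [- Lap u = f - m]. The maximum principle for
   [Gam u] gives [K^2 Gam u <= D / 2], whence [|f - m| <= D / K] by
   Cauchy-Schwarz. Both bounds are attained, which forces [Lap f = - K (f - m)]
   and [Gam f = D / 2] everywhere. So the graph is [D]-regular, edges join
   consecutive distance shells, [K = 2], and the local rule says that the
   operators moving functions up and down the shells satisfy the [sl_2]
   relations. This extends any function on the neighbours of [x0] to an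
   eigenfunction for [2], which is again a frame. *)
Require Import Defs.
From HB Require Import structures.
From mathcomp Require Import all_boot all_order all_algebra.
From mathcomp Require Import ring lra zify.
Set Implicit Arguments. Unset Strict Implicit. Unset Printing Implicit Defensive.
Import Order.TTheory GRing.Theory Num.Theory.
Local Open Scope ring_scope.

(** * Gamma calculus *)

Section Calculus.
Variables (R : rcfType) (T : finType) (e : rel T).
Implicit Types (f g h : T -> R) (x y z : T) (c K : R).

Local Notation Lap := (Lap e).
Local Notation Gam := (Gam e).
Local Notation Gam2 := (Gam2 e).

Lemma GamE f g x :
  Gam f g x = (\sum_(y | e x y) (f y - f x) * (g y - g x)) / 2%:R.
Proof.
rewrite /Defs.Gam /Defs.Lap; congr (_ / _).
by rewrite !mulr_sumr -!sumrB; apply: eq_bigr => y _; ring.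
Qed.

Lemma Gam_ge0 f x : 0 <= Gam f f x.
Proof.
rewrite GamE divr_ge0 ?ler0n //; apply: sumr_ge0 => y _.
by rewrite -expr2 sqr_ge0.
Qed.

Lemma eq_Lap f g : f =1 g -> Lap f =1 Lap g.
Proof. by move=> fg x; apply: eq_bigr => y _; rewrite !fg. Qed.

Lemma eq_Gam f f' g g' : f =1 f' -> g =1 g' -> Gam f g =1 Gam f' g'.
Proof. by move=> ff gg x; rewrite !GamE; congr (_ / _); apply: eq_bigr => y _; rewrite !ff !gg. Qed.

Lemma LapDZ f g c x : Lap (fun y => f y + c * g y) x = Lap f x + c * Lap g x.
Proof. by rewrite /Defs.Lap mulr_sumr -big_split; apply: eq_bigr => y _ /=; ring. Qed.

Lemma Lap_affine f c d x : Lap (fun y => c * f y + d) x = c * Lap f x.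
Proof. by rewrite /Defs.Lap mulr_sumr; apply: eq_bigr => y _ /=; ring. Qed.

Lemma GamC f g x : Gam f g x = Gam g f x.
Proof. by rewrite !GamE; congr (_ / _); apply: eq_bigr => y _; rewrite mulrC. Qed.

Lemma GamDZr f g h c x : Gam f (fun y => g y + c * h y) x = Gam f g x + c * Gam f h x.
Proof.
rewrite !GamE mulrA -mulrDl mulr_sumr -big_split /=; congr (_ / _).
by apply: eq_bigr => y _; ring.
Qed.

Lemma GamDZl f g h c x : Gam (fun y => g y + c * h y) f x = Gam g f x + c * Gam h f x.
Proof. by rewrite GamC GamDZr !(GamC f). Qed.

Lemma GamZr f g c x : Gam f (fun y => c * g y) x = c * Gam f g x.
Proof.
by rewrite !GamE mulrA mulr_sumr; congr (_ / _); apply: eq_bigr => y _; ring.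
Qed.

Lemma Gam2_diag f x : Gam2 f f x = Lap (Gam f f) x / 2%:R - Gam f (Lap f) x.
Proof. by rewrite /Defs.Gam2; field. Qed.

Lemma Gam2_perturb f g c x :
  Gam2 (fun y => f y + c * g y) (fun y => f y + c * g y) x =
  Gam2 f f x + 2%:R * c * Gam2 f g x + c ^+ 2 * Gam2 g g x.
Proof.
set h := fun y => _.
have GhE : Gam h h =1 fun y => (Gam f f y + (2%:R * c) * Gam f g y) + c ^+ 2 * Gam g g y.
  by move=> y; rewrite /h GamDZr !GamDZl (GamC g f); ring.
have LhE : Lap h =1 fun y => Lap f y + c * Lap g y by move=> y; rewrite /h LapDZ.
rewrite Gam2_diag (eq_Lap GhE) (eq_Gam (frefl h) LhE) LapDZ LapDZ.
rewrite /h GamDZr !GamDZl !Gam2_diag /Defs.Gam2.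
by rewrite (GamC g (Lap f)); field.
Qed.

Lemma Gam_eq0 f x : Gam f f x = 0 -> forall y, e x y -> f y = f x.
Proof.
move=> G0 y exy; apply/eqP; rewrite -subr_eq0 -sqrf_eq0.
have /eqP := G0; rewrite GamE mulf_eq0 invr_eq0 pnatr_eq0 orbF psumr_eq0; last first.
  by move=> z _; rewrite -expr2 sqr_ge0.
by move/allP => /(_ y (mem_index_enum _)); rewrite exy expr2.
Qed.

Hypothesis e_sym : symmetric e.

Lemma sum_Lap f : \sum_x Lap f x = 0.
Proof.
rewrite /Defs.Lap pair_big_dep /=.
set S := \sum_(p | _) _.
suff: S = - S by move=> H; lra.
rewrite /S -sumrN (reindex_inj (h := fun p : T * T => (p.2, p.1))) /=; last first.
  by move=> [a b] [c d] [-> ->].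
by apply: eq_big => [[a b]|[a b] _] /=; rewrite 1?e_sym // opprB.
Qed.

(** Green's formula: [Lap] is self-adjoint and sums to zero, so summing the definition of [Gam]
    leaves two equal cross terms. *)
Lemma sum_mulLap f g : \sum_x f x * Lap g x = - \sum_x Gam f g x.
Proof.
have H h k : \sum_x h x * Lap k x = \sum_x k x * Lap h x.
  rewrite /Defs.Lap; under eq_bigr do rewrite mulr_sumr.
  under [RHS]eq_bigr do rewrite mulr_sumr.
  rewrite !pair_big_dep /=.
  have E1 a b : \sum_(p : T * T | e p.1 p.2) a p.1 * (b p.2 - b p.1) =
     \sum_(p : T * T | e p.1 p.2) a p.1 * b p.2 - \sum_(p : T * T | e p.1 p.2) a p.1 * b p.1 :> R.
    by rewrite -sumrB; apply: eq_bigr => p _; rewrite mulrBr.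
  rewrite !E1; congr (_ - _); last by apply: eq_bigr => p _; rewrite mulrC.
  rewrite (reindex_inj (h := fun p : T * T => (p.2, p.1))) /=; last first.
    by move=> [a b] [c d] [-> ->].
  by apply: eq_big => [[a b]|[a b] _] /=; rewrite 1?e_sym // mulrC.
rewrite /Defs.Gam -mulr_suml !sumrB sum_Lap H; by field.
Qed.

Lemma sum_Gam2 f : \sum_x Gam2 f f x = - \sum_x Gam f (Lap f) x.
Proof.
under eq_bigr do rewrite Gam2_diag.
by rewrite sumrB -mulr_suml sum_Lap mul0r add0r.
Qed.

Hypothesis e_conn : forall x y, connect e x y.

Lemma connected_ind (P : T -> Prop) x0 :
  P x0 -> (forall x y, P x -> e x y -> P y) -> forall x, P x.
Proof.
move=> P0 PS x; have /connectP[p + ->] := e_conn x0 x.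
elim: p x0 P0 => //= y p IH x0 P0 /andP[exy pp].
by apply: IH pp; apply: PS exy.
Qed.

Lemma connected_const (A : Type) (f : T -> A) :
  (forall x y, e x y -> f y = f x) -> forall x y, f x = f y.
Proof.
move=> fE x y; apply: (@connected_ind (fun z => f z = f y) y) => // a b <- eab.
exact: fE.
Qed.

Lemma Lap0_const f : (forall x, Lap f x = 0) -> forall x y, f x = f y.
Proof.
move=> L0; apply: connected_const => x; apply: Gam_eq0.
have: \sum_x Gam f f x = 0.
  by rewrite -[LHS]opprK -sum_mulLap big1 ?oppr0 // => z _; rewrite L0 mulr0.
move/eqP; rewrite psumr_eq0; last by move=> z _; apply: Gam_ge0.
by move/allP => /(_ x (mem_index_enum _)) /eqP.
Qed.

Section Curved.
Variable K : R.
Hypothesis cd : CD e K.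

(** For an eigenfunction the sum of [Gam2 f f] is [l] times the sum of [Gam f f]; compare this with
    the summed [CD]. *)
Lemma lichnerowicz f (l : R) :
  (forall x, Lap f x = - l * f x) -> (forall x y, f x = f y) \/ K <= l.
Proof.
move=> fE.
have H : K * \sum_x Gam f f x <= l * \sum_x Gam f f x.
  have -> : l * (\sum_x Gam f f x) = \sum_x Gam2 f f x.
    rewrite sum_Gam2 mulr_sumr -sumrN; apply: eq_bigr => x _.
    by rewrite (eq_Gam (frefl f) fE) GamZr; ring.
  by rewrite mulr_sumr; apply: ler_sum => x _; apply: cd.
have := @sumr_ge0 R T (index_enum T) xpredT _ (fun x _ => Gam_ge0 f x).
rewrite le_eqVlt => /orP[/eqP S0|S_gt0]; last by right; rewrite -(ler_pM2r S_gt0).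
left; apply: connected_const => x; apply: Gam_eq0.
move/esym/eqP: S0; rewrite psumr_eq0; last by move=> z _; apply: Gam_ge0.
by move/allP => /(_ x (mem_index_enum _)) /eqP.
Qed.

Section Eigenfunction.
Variable f : T -> R.
Hypothesis fE : forall x, Lap f x = - K * f x.

(** The summed [CD] inequality is an equality here, and nonnegative differences with zero sum all
    vanish. *)
Lemma eigen_Gam2 x : Gam2 f f x = K * Gam f f x.
Proof.
have S0 : \sum_x (Gam2 f f x - K * Gam f f x) = 0.
  rewrite sumrB sum_Gam2 -mulr_sumr -sumrN mulr_sumr -sumrB big1 // => z _.
  by rewrite (eq_Gam (frefl f) fE) GamZr; ring.
move/eqP: S0; rewrite psumr_eq0; last by move=> z _; rewrite subr_ge0; apply: cd.
by move/allP => /(_ x (mem_index_enum _)); rewrite subr_eq0 => /eqP.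
Qed.

(** By [eigen_Gam2] the function [Gam f f] is harmonic. *)
Lemma eigen_Gam_const x y : Gam f f x = Gam f f y.
Proof.
apply: Lap0_const => z; have := eigen_Gam2 z.
by rewrite Gam2_diag (eq_Gam (frefl f) fE) GamZr => H; lra.
Qed.

(* The quadratic form [Gam2 - K Gam] at [x] is nonnegative and vanishes at [f],
   so its polarization at [f] kills every function; test it on the indicator
   of [z]. *)
Lemma eigen_square x z : x != z -> ~~ e x z ->
  \sum_(y | e x y && e y z) (f x + f z - 2%:R * f y) = 0.
Proof.
move=> xz nexz; pose d y : R := (y == z)%:R.
have Gd g y : Gam g d y = ((e y z)%:R * (g z - g y) - d y * Lap g y) / 2%:R.
  rewrite GamE; congr (_ / _).
  have -> : \sum_(w | e y w) (g w - g y) * (d w - d y) =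
    \sum_(w | e y w) d w * (g w - g y) - d y * Lap g y.
    by rewrite /Defs.Lap mulr_sumr -sumrB; apply: eq_bigr => w _; ring.
  congr (_ - _); rewrite big_mkcond /= (bigD1 z) //= /d eqxx mul1r.
  rewrite big1 ?addr0; first by case: (e y z); rewrite ?mul1r ?mul0r.
  by move=> w /negbTE ->; rewrite mul0r if_same.
have dx : d x = 0 by rewrite /d (negbTE xz).
have Ld y : Lap d y = (e y z)%:R - d y * \sum_(w | e y w) 1.
  rewrite /Defs.Lap sumrB mulr_sumr; congr (_ - _); last first.
    by apply: eq_bigr => w _; rewrite mulr1.
  rewrite big_mkcond /= (bigD1 z) //= /d eqxx big1 ?addr0; first by case: (e y z).
  by move=> w /negbTE ->; rewrite if_same.
have Gx g : Gam g d x = 0 by rewrite Gd dx (negbTE nexz) !mul0r subrr mul0r.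
have ny y : e x y -> d y = 0.
  by move=> exy; rewrite /d; case: eqP => // yz; rewrite -yz exy in nexz.
(* [d] vanishes at [x] and at its neighbours, so only the two-step walks from [x] to [z]
   contribute. *)
have B : Gam2 f d x = 4%:R^-1 * \sum_(y | e x y && e y z) (f x + f z - 2%:R * f y).
  rewrite /Defs.Gam2 [Gam d (Lap f) x]GamC (Gx (Lap f)) subr0 [Lap (Gam f d) x]/Defs.Lap.
  rewrite (GamE f (Lap d)) [RHS]mulr_sumr big_mkcondr /= mulr_suml -sumrB mulr_suml.
  apply: eq_bigr => y exy.
  rewrite (Gx f) Gd !Ld dx (ny y exy) (negbTE nexz) !mul0r !subr0.
  by case: (e y z) => /=; field.
have Q t : 0 <= 2%:R * t * Gam2 f d x + t ^+ 2 * Gam2 d d x.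
  have := cd (fun y => f y + t * d y) x.
  rewrite Gam2_perturb eigen_Gam2 GamDZl !GamDZr (GamC d f) !Gx.
  by move=> H; lra.
set b := Gam2 f d x in B Q; set a := Gam2 d d x in Q.
have b0 : b = 0.
  have a0 : 0 <= a by have := Q 1; have := Q (-1); rewrite sqrrN !expr1n => H1 H2; lra.
  have a1 : 0 < 1 + a by lra.
  (* Close to the minimizer [- b / a] of the quadratic, but with a denominator that stays positive
     when [a = 0]. *)
  have := Q (- (b / (1 + a))).
  have -> : 2%:R * (- (b / (1 + a))) * b + (- (b / (1 + a))) ^+ 2 * a =
     - ((b / (1 + a)) ^+ 2 * (2%:R + a)) by field; lra.
  rewrite oppr_ge0 => H.
  have: (b / (1 + a)) ^+ 2 * (2%:R + a) = 0.
    by apply/le_anti; rewrite H mulr_ge0 ?sqr_ge0 //; lra.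
  move/eqP; rewrite mulf_eq0 sqrf_eq0 mulf_eq0 invr_eq0 (gt_eqF a1) orbF.
  by case/orP => /eqP // H2; lra.
by move: B; rewrite b0 => /esym/eqP; rewrite mulf_eq0 invr_eq0 pnatr_eq0 /= => /eqP.
Qed.

End Eigenfunction.
End Curved.
End Calculus.

(** * Commuting flips *)

Definition flip (D : nat) (i : 'I_D) (A : {set 'I_D}) : {set 'I_D} :=
  [set j | (j \in A) (+) (j == i)].

Lemma in_flip D (i j : 'I_D) A : (j \in flip i A) = (j \in A) (+) (j == i).
Proof. by rewrite inE. Qed.

Lemma flipK D (i : 'I_D) : involutive (flip i).
Proof. by move=> A; apply/setP => j; rewrite !in_flip -addbA addbb addbF. Qed.

Lemma hc_adjP D (A B : {set 'I_D}) : reflect (exists i, B = flip i A) (hc_adj A B).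
Proof.
rewrite /hc_adj; apply: (iffP cards1P) => -[i iP]; exists i.
  apply/setP => j; rewrite in_flip -in_set1 -iP !inE.
  by case: (j \in A); case: (j \in B).
apply/setP => j; rewrite iP !inE; by case: (j \in A); case: (j == i).
Qed.

Section Flips.
Variables (T : finType) (e : rel T) (D : nat) (x0 : T).
Hypothesis e_conn : forall x y, connect e x y.
Variables (phi : T -> {set 'I_D}) (s : 'I_D -> T -> T).
Hypotheses (s_adj : forall x i, e x (s i x))
           (s_onto : forall x y, e x y -> exists i, y = s i x)
           (phi_s : forall i x, phi (s i x) = flip i (phi x))
           (sK : forall i, involutive (s i))
           (sC : forall i j x, s i (s j x) = s j (s i x)).

Lemma foldr_rem_flip i t x : i \in t -> foldr s x t = s i (foldr s x (rem i t)).
Proof.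
elim: t => //= j t IH; rewrite inE eq_sym; case: eqP => [->//|_] /= it.
by rewrite sC -IH.
Qed.

(** A repeated flip along a walk cancels its earlier occurrence, since flips commute and are
    involutions. *)
Lemma foldr_flips_onto y x : exists2 t, uniq t & x = foldr s y t.
Proof.
have /connectP[p + ->] := e_conn y x; elim/last_ind: p => [|p z IH]; first by exists [::].
rewrite rcons_path last_rcons => /andP[/IH[t ut ->]] /s_onto[i ->].
have [it|it] := boolP (i \in t); last by exists (i :: t); rewrite //= it.
by exists (rem i t); rewrite ?rem_uniq // (foldr_rem_flip _ it) sK.
Qed.

Lemma phi_foldr x t i : uniq t -> (i \in phi (foldr s x t)) = (i \in phi x) (+) (i \in t).
Proof.
elim: t => [|j t IH] /=; first by rewrite addbF.
case/andP => jt ut; rewrite phi_s in_flip IH // inE.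
by case: eqP => [->|_]; rewrite ?(negbTE jt) ?addbF ?orbF.
Qed.

Lemma cube_of_flips : iso_hypercube e D.
Proof.
(* A repetition-free word toggles every coordinate it lists, so a word joining two points of equal
   image is empty. *)
have phi_inj : injective phi.
  move=> x y pxy; have [t ut yE] := foldr_flips_onto x y.
  case: t ut yE => [//|i t] ut yE; have := phi_foldr x i ut.
  by rewrite -yE pxy mem_head addbT; case: (_ \in _).
exists phi; split; last first.
  move=> x y; apply/idP/hc_adjP => [/s_onto[i ->]|[i yx]]; first by exists i.
  by rewrite (phi_inj y (s i x)) ?phi_s.
pose psi (A : {set _}) := foldr s x0 (enum [set i | (i \in phi x0) (+) (i \in A)]).
have psiK : cancel psi phi.
  by move=> A; apply/setP => i; rewrite phi_foldr ?enum_uniq // mem_enum inE addbA addbb.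
by exists psi => // x; apply: phi_inj; rewrite psiK.
Qed.
End Flips.

(** * Orthonormal frames of eigenfunctions *)

Section Frame.
Variables (R : rcfType) (T : finType) (e : rel T).
Hypotheses (e_sym : symmetric e) (e_irr : irreflexive e).
Hypothesis e_conn : forall x y, connect e x y.
Variables (K : R) (D : nat) (x0 : T) (nb : 'I_D -> T) (F : 'I_D -> T -> R).
Hypotheses (cd : CD e K) (deg_le : forall x, (#|[pred y | e x y]| <= D)%N).
Hypotheses (nb_adj : forall j, e x0 (nb j))
           (nb_onto : forall y, e x0 y -> exists j, y = nb j).
Hypotheses (F_eigen : forall i x, Lap e (F i) x = - K * F i x)
           (F_nb : forall i j, F i (nb j) - F i x0 = (i == j)%:R).

(** [Gam] is constant for [F i], [F j] and their sum, hence by polarization for the mixed term,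
    which [F_nb] evaluates at [x0]. *)
Lemma frame_rows i j x :
  \sum_(y | e x y) (F i y - F i x) * (F j y - F j x) = (i == j)%:R.
Proof.
have GE y : Gam e (F i) (F j) y = Gam e (F i) (F j) x0.
  have E z : Lap e (fun y => F i y + 1 * F j y) z = - K * (F i z + 1 * F j z).
    by rewrite LapDZ !F_eigen; ring.
  have := eigen_Gam_const e_sym e_conn cd E y x0.
  rewrite !(GamDZl, GamDZr) !(GamC e (F j) (F i)).
  rewrite (eigen_Gam_const e_sym e_conn cd (F_eigen i) y x0).
  rewrite (eigen_Gam_const e_sym e_conn cd (F_eigen j) y x0).
  by move=> H; lra.
have nb_inj : injective nb.
  move=> a b ab; have := F_nb a a; rewrite ab F_nb eqxx.
  by case: eqP => // _ /eqP; rewrite eq_sym oner_eq0.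
have := GE x; rewrite !GamE => /(congr1 (fun t => t * 2%:R)).
rewrite !divfK ?pnatr_eq0 // => ->.
rewrite (eq_bigl (mem (codom nb))); last first.
  move=> y; apply/idP/codomP => [/nb_onto[k ->]|[k ->]]; last exact: nb_adj.
  by exists k.
rewrite -big_uniq /=; last by rewrite /codom /image_mem map_inj_uniq ?enum_uniq.
rewrite big_image /= (bigD1 i) //= !F_nb eqxx mul1r big1 ?addr0 1?eq_sym //.
by move=> k ki; rewrite F_nb eq_sym (negbTE ki) mul0r.
Qed.

(** With [F] read as a map into [R^D], the Gram matrix of the edge vectors leaving [x]. *)
Definition edgeprod x y z : R := \sum_i (F i y - F i x) * (F i z - F i x).

(* With [P = edgeprod x], the squared Frobenius norm of [P - 1] is
   [deg x - D <= 0]: a matrix with orthonormal rows and at most as many columns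
   as rows is orthogonal. *)
Lemma frame_cols x y z : e x y -> e x z -> edgeprod x y z = (y == z)%:R.
Proof.
pose N := [pred y | e x y].
(* If [A] has the edge vectors at [x] as columns, the traces of [(A^T A)^2] and [(A A^T)^2] agree,
   and [A A^T = 1] by [frame_rows]. *)
have PP : \sum_(y in N) \sum_(z in N) edgeprod x y z ^+ 2 = D%:R.
  transitivity (\sum_i \sum_j
     (\sum_(y | e x y) (F i y - F i x) * (F j y - F j x)) ^+ 2 : R).
    transitivity (\sum_(y in N) \sum_(z in N) \sum_i \sum_j
      ((F i y - F i x) * (F j y - F j x)) * ((F i z - F i x) * (F j z - F j x))).
      apply: eq_bigr => a _; apply: eq_bigr => b _.
      rewrite /edgeprod expr2 mulr_suml; apply: eq_bigr => i _.
      by rewrite mulr_sumr; apply: eq_bigr => j _; ring.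
    under eq_bigr do rewrite exchange_big /=.
    rewrite exchange_big /=; apply: eq_bigr => i _.
    under eq_bigr do rewrite exchange_big /=.
    rewrite exchange_big /=; apply: eq_bigr => j _.
    rewrite expr2 mulr_suml; apply: eq_bigr => a _.
    by rewrite mulr_sumr.
  transitivity (\sum_(i < D) 1 : R); last by rewrite sumr_const card_ord.
  apply: eq_bigr => i _; rewrite (bigD1 i) //= frame_rows eqxx expr1n big1 ?addr0 //.
  by move=> j ji; rewrite frame_rows eq_sym (negbTE ji) expr0n.
have PT : \sum_(y in N) edgeprod x y y = D%:R.
  rewrite /edgeprod exchange_big /=.
  under eq_bigr do rewrite frame_rows eqxx.
  by rewrite sumr_const card_ord.
have S0 : \sum_(y in N) \sum_(z in N) (edgeprod x y z - (y == z)%:R) ^+ 2 <= 0.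
  have -> : \sum_(y in N) \sum_(z in N) (edgeprod x y z - (y == z)%:R) ^+ 2 =
     \sum_(y in N) \sum_(z in N) edgeprod x y z ^+ 2
       - 2%:R * (\sum_(y in N) edgeprod x y y) + \sum_(y in N) 1.
    rewrite mulr_sumr -sumrB -big_split /=; apply: eq_bigr => a aN.
    rewrite (bigD1 a) //= [in RHS](bigD1 a) //= eqxx.
    have -> : \sum_(z in N | z != a) (edgeprod x a z - (a == z)%:R) ^+ 2 =
              \sum_(z in N | z != a) edgeprod x a z ^+ 2.
      by apply: eq_bigr => b /andP[_ ba]; rewrite eq_sym (negbTE ba) subr0.
    rewrite /= mulr1n; ring.
  rewrite PP PT sumr_const.
  have : #|N|%:R <= D%:R :> R by rewrite ler_nat; apply: deg_le.
  by move=> H; lra.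
have nn a : 0 <= \sum_(b in N) (edgeprod x a b - (a == b)%:R) ^+ 2.
  by apply: sumr_ge0 => b _; apply: sqr_ge0.
have {}S0 : \sum_(y in N) \sum_(z in N) (edgeprod x y z - (y == z)%:R) ^+ 2 == 0.
  by rewrite eq_le S0 sumr_ge0.
move=> exy exz; move: S0; rewrite psumr_eq0 // => /allP/(_ y (mem_index_enum _)).
rewrite inE exy /= psumr_eq0; last by move=> b _; apply: sqr_ge0.
by move=> /allP/(_ z (mem_index_enum _)); rewrite inE exz /= sqrf_eq0 subr_eq0 => /eqP.
Qed.

(** The vector from [x] to [z] is split at [y]. *)
Lemma edgeprod_shift x y z :
  edgeprod x y z = edgeprod x y y - edgeprod y x z.
Proof. by rewrite /edgeprod -sumrB; apply: eq_bigr => i _; ring. Qed.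

(** Sum [edgeprod x y z] over the neighbours [z] of [x]: orthonormality leaves only [z = y], while
    in each coordinate the increments add up to the Laplacian. *)
Lemma edgeprod_grad x y : e x y -> \sum_i (F i y - F i x) * (- K * F i x) = 1.
Proof.
move=> exy; transitivity (\sum_(z | e x z) edgeprod x y z).
  rewrite /edgeprod exchange_big /=; apply: eq_bigr => i _.
  by rewrite -mulr_sumr -F_eigen.
rewrite (bigD1 y) //= frame_cols // eqxx big1 ?addr0 // => z /andP[exz zy].
by rewrite frame_cols // eq_sym (negbTE zy).
Qed.

(** In a triangle, [edgeprod_shift] would read [0 = 1 - 0]. *)
Lemma frame_no_triangle x y z : e x y -> e y z -> ~~ e x z.
Proof.
move=> exy eyz; apply/negP => exz.
have eyx : e y x by rewrite e_sym.
have yz : y != z by apply: contraTneq eyz => ->; rewrite e_irr.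
have xz : x != z by apply: contraTneq exz => ->; rewrite e_irr.
have := edgeprod_shift x y z.
rewrite !frame_cols // (negbTE yz) (negbTE xz) eqxx => /eqP.
by rewrite subr0 eq_sym oner_eq0.
Qed.

(** Adding [edgeprod_grad] for both orientations of the edge equates [1 + 1] with [K] times its
    squared length, which is [1]. *)
Lemma frame_curvature x y : e x y -> K = 2%:R.
Proof.
move=> exy; have eyx : e y x by rewrite e_sym.
have := congr2 +%R (edgeprod_grad exy) (edgeprod_grad eyx).
rewrite -big_split /= (eq_bigr (fun i => K * ((F i y - F i x) * (F i y - F i x)))).
  by rewrite -mulr_sumr -/(edgeprod x y y) frame_cols // eqxx mulr1.
by move=> i _; ring.
Qed.

Lemma frame_square x y z : e x y -> e y z -> z != x ->
  exists y', [/\ e x y', e y' z, y' != y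
    & forall i, F i z - F i y = F i y' - F i x].
Proof.
move=> exy eyz zx.
have eyx : e y x by rewrite e_sym.
have nexz := frame_no_triangle exy eyz.
have xz : x != z by rewrite eq_sym.
pose C := [pred w | e x w && e w z].
have sq i : \sum_(w in C) (F i x + F i z - 2%:R * F i w) = 0.
  exact: (eigen_square e_sym cd (F_eigen i) xz nexz).
have yC : y \in C by rewrite inE exy.
have xyz : edgeprod x y z = 1.
  by rewrite edgeprod_shift !frame_cols // eqxx (negbTE xz) subr0.
(* Pairing the square rule with the vector from [x] to [y] gives [1 - 2] for [w = y] and [1] for any
   other [w], so [#|C| - 2 = 0]. *)
have C2 : #|C|%:R = 2%:R :> R.
  have: \sum_i (F i y - F i x) * \sum_(w in C) (F i x + F i z - 2%:R * F i w) = 0.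
    by rewrite big1 // => i _; rewrite sq mulr0.
  under eq_bigr do rewrite mulr_sumr.
  rewrite exchange_big /=.
  rewrite (eq_bigr (fun w => 1 - 2%:R * (y == w)%:R)); last first.
    move=> w /andP[exw _]; rewrite -(frame_cols exy exw) -[X in X - _]xyz.
    rewrite /edgeprod mulr_sumr -sumrB.
    by apply: eq_bigr => i _; ring.
  rewrite sumrB sumr_const -mulr_sumr (bigD1 y) //= eqxx big1 ?addr0.
    by rewrite /= !mulr1n => H; lra.
  by move=> w /andP[_ wy]; rewrite eq_sym (negbTE wy).
have /eqP : #|C| = 2%N by apply/eqP; rewrite -(eqr_nat R) C2.
rewrite (cardD1 y) yC add1n eqSS => /eqP /mem_card1[y' y'P].
have := y'P y'; rewrite !inE eqxx => /and3P[y'y exy' ey'z].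
exists y'; split => // i.
have := sq i; rewrite (bigD1 y) //= (bigD1 y') /=; last by rewrite inE exy' ey'z.
rewrite big1; first by move=> H; lra.
move=> w /andP[/andP[wC wy] wy'].
by have := y'P w; rewrite !inE wy (negbTE wy'); move: wC; rewrite inE => ->.
Qed.

(** Induction along walks from [x0]: an edge at the new vertex either goes back, or is parallel, by
    [frame_square], to an edge at the previous vertex. *)
Lemma frame_axis x y : e x y ->
  exists i, forall j, (F j y - F j x) ^+ 2 = (i == j)%:R.
Proof.
move: x y; apply: (connected_ind e_conn (x0 := x0)).
  move=> y /nb_onto[i ->]; exists i => j; rewrite F_nb eq_sym.
  by case: eqP; rewrite ?expr1n ?expr0n.
move=> x y IH exy z eyz; have [->|zx] := eqVneq z x.
  by have [i iP] := IH y exy; exists i => j; rewrite -iP; ring.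
have [y' [exy' _ _ E]] := frame_square exy eyz zx.
by have [i iP] := IH y' exy'; exists i => j; rewrite E.
Qed.

(** The unit row norm provides an edge that moves [F i]. This edge has axis [i] and exhausts the
    norm, so the eigenvalue equation at [x] reduces to [F i y - F i x = - 2 F i x]. *)
Lemma frame_flip x i : exists y,
  e x y /\ forall j, F j y = if j == i then - F j x else F j x.
Proof.
have /eqP S1 := frame_rows i i x.
have [y exy yi] : exists2 y, e x y & F i y - F i x != 0.
  case: (pickP [pred y | e x y & F i y - F i x != 0]) => [y /andP[]|H]; first by exists y.
  move/eqP: S1; rewrite eqxx big1 => [|y exy]; first by move/esym/eqP; rewrite oner_eq0.
  by have := H y; rewrite /= exy => /negbFE/eqP ->; rewrite mul0r.
have [k kP] := frame_axis exy.
have ki : k = i.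
  by apply/eqP; move: (kP i); case: eqP => // _ /eqP; rewrite sqrf_eq0 (negbTE yi).
rewrite {}ki {k} in kP; exists y; split=> // j.
have R0 : \sum_(z | e x z && (z != y)) (F i z - F i x) ^+ 2 = 0.
  have := eqP S1; rewrite (bigD1 y) //= -expr2 kP eqxx /= => H.
  by under eq_bigr do rewrite expr2; lra.
have := F_eigen i x; rewrite /Lap (bigD1 y) //= (frame_curvature exy) big1; last first.
  move=> z zP; apply/eqP; rewrite -sqrf_eq0; move/eqP: R0.
  rewrite psumr_eq0; last by move=> w _; apply: sqr_ge0.
  by move/allP => /(_ z (mem_index_enum _)); rewrite zP.
case: eqP => [->|/eqP ji] H; first by lra.
by apply/eqP; rewrite -subr_eq0 -sqrf_eq0 kP (eq_sym i) (negbTE ji).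
Qed.

(** The edge negating coordinate [i] has the single nonzero entry [- 2 F i x] and length [1]. *)
Lemma frame_coord x i : F i x ^+ 2 = 4%:R^-1.
Proof.
have [y [exy yP]] := frame_flip x i.
have [k kP] := frame_axis exy.
have := kP i; rewrite yP eqxx => H.
have : edgeprod x y y = 1 by rewrite frame_cols // eqxx.
rewrite /edgeprod (bigD1 i) //= big1 => [|j /negbTE ji]; last by rewrite yP ji subrr mul0r.
rewrite yP eqxx => H2; lra.
Qed.

Lemma frame_flip_inj x y z i : e x y -> e x z ->
  (forall j, F j y = if j == i then - F j x else F j x) ->
  (forall j, F j z = if j == i then - F j x else F j x) -> y = z.
Proof.
move=> exy exz yP zP; apply/eqP; have := frame_cols exy exz.
rewrite (_ : edgeprod x y z = edgeprod x y y); last first.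
  by apply: eq_bigr => j _; rewrite yP zP.
by rewrite frame_cols // eqxx; case: eqP => // _ /eqP; rewrite oner_eq0.
Qed.

Lemma frame_step x y : e x y ->
  exists i, forall j, F j y = if j == i then - F j x else F j x.
Proof.
move=> exy; have [i iP] := frame_axis exy; exists i => j.
have := iP j; have := frame_coord y j; have := frame_coord x j.
rewrite (eq_sym j); case: eqP => _ /= Hx Hy H.
  have /eqP: (F j y + F j x) ^+ 2 = 0 by move: H; rewrite mulr1n => H; lra.
  by rewrite sqrf_eq0 addr_eq0 => /eqP.
by apply/eqP; rewrite -subr_eq0 -sqrf_eq0 H.
Qed.

Lemma frame_iso : iso_hypercube e D.
Proof.
have [s0 s0P] := fin_all_exists (fun p : T * 'I_D => frame_flip p.1 p.2).
pose s i x := s0 (x, i).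
have es x i : e x (s i x) by have [] := s0P (x, i).
have Fs x i j : F j (s i x) = if j == i then - F j x else F j x.
  by have [_ ->] := s0P (x, i).
have sK i x : s i (s i x) = x.
  apply: (@frame_flip_inj (s i x) _ _ i) => //; first by rewrite e_sym.
  by move=> j; rewrite Fs; case: eqP => // _; rewrite opprK.
have F_neq0 i x : F i x != 0.
  by rewrite -sqrf_eq0 frame_coord invr_eq0 pnatr_eq0.
(* All coordinates are [1/2] or [-1/2] by [frame_coord], so their signs retain all of [F]. *)
pose phi x := [set i | 0 < F i x].
apply: (@cube_of_flips _ e D x0 e_conn phi s) => //.
- move=> x y exy; have [i iP] := frame_step exy.
  by exists i; apply: (frame_flip_inj exy (es x i) iP).
- move=> i x; apply/setP => j.
  rewrite /phi !inE Fs; case: eqP => _; last by rewrite addbF.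
  by rewrite addbT oppr_gt0 -leNgt le_eqVlt (negbTE (F_neq0 _ _)).
move=> i j x; have [->//|ij] := eqVneq i j.
have zx : s i (s j x) != x.
  apply/eqP => /(congr1 (F i)); rewrite !Fs eqxx (negbTE ij) => H.
  by have /eqP := F_neq0 i x; apply; lra.
(* The fourth corner [y'] of this square is [s i x], and the corner opposite to [x] is then
   [s j y']. *)
have [y' [exy' ey'z _ E]] := frame_square (es x j) (es (s j x) i) zx.
have y'E : y' = s i x.
  apply: (frame_flip_inj exy' (es x i)) => // k.
  have := E k; rewrite !Fs; case: (eqVneq k i) => [->|ki]; last by case: eqP => _ H; lra.
  by rewrite (negbTE ij) => H; lra.
rewrite -y'E; apply: (@frame_flip_inj y' _ _ j) => // k.
have := E k; rewrite y'E !Fs; case: (eqVneq k i) => [->|ki]; case: eqP => _ H; lra.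
Qed.
End Frame.

(** * Distances and the Poisson equation *)

Section Distance.
Variables (T : finType) (e : rel T).

Lemma walkP n x y :
  reflect (exists p, [/\ size p = n, path e x p & last x p = y]) (walk e n x y).
Proof.
apply: (iffP existsP) => [[p /andP[pp /eqP lp]]|[p [sp pp lp]]].
  by exists p; rewrite size_tuple.
by exists (tcast sp (in_tuple p)); rewrite val_tcast pp lp eqxx.
Qed.

Lemma gdist_le n x y : walk e n x y -> (gdist e x y <= n)%N.
Proof.
move=> w; rewrite leqNgt; apply/negP => lt_n.
(* A failed [find] returns [#|T|], so any [n] below its value lies in the searched range. *)
have n_lt : (n < #|T|)%N.
  by apply: leq_trans lt_n _; rewrite /gdist (leq_trans (find_size _ _)) ?size_iota.
by have := before_find 0%N lt_n; rewrite nth_iota // add0n w.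
Qed.

Lemma gdistxx x : gdist e x x = 0%N.
Proof. by apply/eqP; rewrite -leqn0; apply: gdist_le; apply/walkP; exists [::]. Qed.

Hypothesis e_conn : forall x y, connect e x y.

Lemma gdist_walk x y : walk e (gdist e x y) x y.
Proof.
rewrite /gdist; set s := iota _ _.
suff: has (fun n => walk e n x y) s.
  move=> hs; have := nth_find 0%N hs; rewrite nth_iota //.
  by rewrite has_find size_iota in hs.
(* A walk without repeated vertices has fewer than [#|T|] edges, hence lies in the searched
   range. *)
have /connectP[p0 /shortenP[p pp up _] ->] := e_conn x y.
apply/hasP; exists (size p); last by apply/walkP; exists p.
by rewrite mem_iota add0n /= -[(size p).+1]/(size (x :: p)) -(card_uniqP up) max_card.
Qed.

Lemma gdist_eq0 x y : gdist e x y = 0%N -> x = y.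
Proof. by move=> d0; have /walkP[p [/eqP]] := gdist_walk x y; rewrite d0 size_eq0 => /eqP ->. Qed.

Lemma gdist_step z x y : e x y -> (gdist e z y <= (gdist e z x).+1)%N.
Proof.
move=> exy; have /walkP[p [sp pp lp]] := gdist_walk z x.
apply: gdist_le; apply/walkP; exists (rcons p y).
by rewrite size_rcons sp rcons_path pp lp last_rcons.
Qed.

Lemma diam_attained (x : T) : exists y z, gdist e y z = diam e.
Proof.
have T0 : (0 < #|T|)%N by apply/card_gt0P; exists x.
have [y dy] := @bigop.eq_bigmax _ (fun y : T => \max_(z : T) gdist e y z)%N T0.
have [z dz] := @bigop.eq_bigmax _ (fun z : T => gdist e y z) T0.
by exists y, z; rewrite /diam dy dz.
Qed.

End Distance.

Lemma deg_le_maxdeg (T : finType) (e : rel T) x : (#|[pred y | e x y]| <= maxdeg e)%N.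
Proof. exact: (@leq_bigmax _ (fun x => #|[pred y | e x y]|)). Qed.

Section Poisson.
Variables (R : rcfType) (T : finType) (e : rel T).
Hypotheses (e_sym : symmetric e) (e_conn : forall x y, connect e x y).

(** An injective endomorphism of a finite-dimensional space is onto. Functions are coded as row
    vectors; the first hypothesis makes [L] respect the coding. *)
Lemma linear_inj_onto (L : (T -> R) -> T -> R) :
  (forall f g, f =1 g -> L f =1 L g) ->
  (forall f g c x, L (fun y => f y + c * g y) x = L f x + c * L g x) ->
  (forall f, (forall x, L f x = 0) -> forall x, f x = 0) ->
  forall f, exists u, forall x, L u x = f x.
Proof.
move=> Lext Llin Linj f.
pose fn (v : 'rV[R]_#|T|) : T -> R := fun x => v 0 (enum_rank x).
pose Lr (v : 'rV[R]_#|T|) : 'rV[R]_#|T| := \row_i L (fn v) (enum_val i).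
have Lr_lin : linear Lr.
  move=> a v w; apply/rowP => i; rewrite !mxE addrC -Llin; apply: Lext => y.
  by rewrite /fn !mxE addrC.
pose M := lin1_mx (HB.pack Lr (GRing.isLinear.Build _ _ _ _ Lr Lr_lin) : {linear _ -> _}).
have MP v : v *m M = Lr v by rewrite mul_rV_lin1.
have : row_free M.
  apply/row_freeP; exists (invmx M); apply: mulmxV.
  rewrite -row_free_unit -kermx_eq0 -submx0; apply/rV_subP => v /sub_kermxP vM.
  rewrite submx0; apply/eqP/rowP => i; rewrite mxE.
  have := Linj (fn v); rewrite /fn => H; rewrite -[i]enum_valK H // => x.
  by move: vM; rewrite MP => /rowP/(_ (enum_rank x)); rewrite !mxE enum_rankK.
rewrite row_free_unit => uM.
pose w : 'rV[R]_#|T| := \row_i f (enum_val i).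
exists (fn (w *m invmx M)) => x.
have : Lr (w *m invmx M) = w by rewrite -MP mulmxKV.
by move/rowP/(_ (enum_rank x)); rewrite !mxE enum_rankK.
Qed.

Lemma poisson_solvable (f : T -> R) :
  exists u m, forall x, Lap e u x = m - f x.
Proof.
(* Adding the total sum makes [- Lap], whose kernel is the constants, injective; that sum then
   serves as [m]. *)
have [u uE] : exists u, forall x, - Lap e u x + \sum_y u y = f x.
  apply: linear_inj_onto f.
  - move=> f g fg x; rewrite (eq_Lap _ fg); congr (_ + _).
    by apply: eq_bigr => y _; rewrite fg.
  - by move=> f g c x; rewrite LapDZ big_split /= -mulr_sumr; ring.
  move=> f f0 x.
  have S0 : \sum_y f y = 0.
    have : \sum_x (- Lap e f x + \sum_y f y) = 0 by rewrite big1.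
    rewrite big_split /= sumrN sum_Lap // oppr0 add0r sumr_const => /eqP.
    by rewrite mulrn_eq0 => /orP[/eqP/card0_eq/(_ x)//|/eqP].
  have fc : forall x y, f x = f y.
    apply: (Lap0_const e_sym e_conn) => y.
    by have := f0 y; rewrite S0 addr0 => /eqP; rewrite oppr_eq0 => /eqP.
  move: S0; rewrite (eq_bigr (fun=> f x)) ?sumr_const => [/eqP|y _]; last exact: fc.
  by rewrite mulrn_eq0 => /orP[/eqP/card0_eq/(_ x)//|/eqP].
by exists u, (\sum_y u y) => x; rewrite -uE; ring.
Qed.
End Poisson.

(** * Extremal diameter *)

(** Cauchy-Schwarz against the constant [1], by Lagrange's identity. *)
Lemma sqr_sum_le (R : realFieldType) (T : finType) (P : pred T) (a : T -> R) :
  (\sum_(x | P x) a x) ^+ 2 <= #|P|%:R * \sum_(x | P x) a x ^+ 2.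
Proof.
suff: 0 <= 2%:R * (#|P|%:R * (\sum_(x | P x) a x ^+ 2) - (\sum_(x | P x) a x) ^+ 2).
  by move=> H; lra.
have <- : \sum_(x | P x) \sum_(y | P y) (a x - a y) ^+ 2 =
  2%:R * (#|P|%:R * (\sum_(x | P x) a x ^+ 2) - (\sum_(x | P x) a x) ^+ 2).
  transitivity (\sum_(x | P x) (#|P|%:R * a x ^+ 2
     - 2%:R * (a x * \sum_(y | P y) a y) + \sum_(y | P y) a y ^+ 2)).
    apply: eq_bigr => x _.
    rewrite (eq_bigr (fun y => a x ^+ 2 - 2%:R * a x * a y + a y ^+ 2)).
      by rewrite big_split sumrB /= sumr_const -mulr_sumr -[_ *+ #|P|]mulr_natl mulrA.
    by move=> y _; ring.
  rewrite big_split sumrB /= sumr_const -mulr_sumr -mulr_sumr -mulr_suml -mulr_natl.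
  by ring.
by apply: sumr_ge0 => x _; apply: sumr_ge0 => y _; apply: sqr_ge0.
Qed.

Section Gradient.
Variables (R : rcfType) (T : finType) (e : rel T).
Hypotheses (e_sym : symmetric e) (e_conn : forall x y, connect e x y).
Variables (K m : R) (f u : T -> R).
Hypotheses (K_gt0 : 0 < K) (cd : CD e K) (uE : forall x, Lap e u x = m - f x).

Let h y := f y + (- K) * u y.

(** [CD] at [u], where the Poisson equation turns [Gam u (Lap u)] into [- Gam u f]; completing the
    square with [h = f - K u] removes this cross term. *)
Lemma poisson_Gam x :
  K ^+ 2 * Gam e u u x + Gam e h h x <= K * Lap e (Gam e u u) x + Gam e f f x.
Proof.
have := cd u x; rewrite Gam2_diag.
have -> : Gam e u (Lap e u) x = - Gam e u f x.
  rewrite -mulN1r -GamZr !GamE; congr (_ / _); apply: eq_bigr => y _.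
  by rewrite !uE; ring.
rewrite -(ler_pM2l K_gt0) /h GamDZr !GamDZl (GamC e f u) => H; lra.
Qed.

Variable C : R.
Hypothesis f_le : forall x, Gam e f f x <= C.

(* Maximum principle: at a maximum of [Gam u u] its Laplacian is [<= 0]. *)
Lemma poisson_Gam_le x : K ^+ 2 * Gam e u u x <= C.
Proof.
case: (@arg_maxP _ _ T x xpredT (Gam e u u) isT) => y _ ymax.
apply: le_trans (_ : K ^+ 2 * Gam e u u y <= C).
  by rewrite ler_wpM2l ?sqr_ge0 //; apply: ymax.
have := poisson_Gam y; have := f_le y; have := Gam_ge0 e h y.
have : K * Lap e (Gam e u u) y <= 0.
  rewrite pmulr_rle0 //; apply: sumr_le0 => z _; rewrite subr_le0; exact: ymax.
move=> H1 H2 H3 H4; lra.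
Qed.

(** Where the bound is attained, [Lap (Gam u u)] and [Gam h h] vanish. The first spreads the maximum
    to all neighbours, hence everywhere; the second makes [h] constant, so [Lap f = K Lap u]. *)
Lemma poisson_Gam_rigid x1 : K ^+ 2 * Gam e u u x1 = C ->
  (forall x, Gam e f f x = C) /\
  forall x, Lap e f x = - K * (f x - m).
Proof.
move=> x1P.
have local x : K ^+ 2 * Gam e u u x = C ->
    [/\ Lap e (Gam e u u) x = 0, Gam e h h x = 0 & Gam e f f x = C].
  move=> xP; have L0 : Lap e (Gam e u u) x <= 0.
    apply: sumr_le0 => y _; rewrite subr_le0 -(ler_pM2l (exprn_gt0 2 K_gt0)) xP.
    exact: poisson_Gam_le.
  have K0 : K * Lap e (Gam e u u) x <= 0 by rewrite pmulr_rle0.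
  have := poisson_Gam x; have := f_le x; have := Gam_ge0 e h x; rewrite xP.
  move=> H1 H2 H3; split; try lra.
  have /eqP : K * Lap e (Gam e u u) x = 0 by lra.
  by rewrite mulf_eq0 (gt_eqF K_gt0) => /eqP.
have all_max : forall x, K ^+ 2 * Gam e u u x = C.
  apply: (connected_ind e_conn x1P) => x y xP exy; have [L0 _ _] := local x xP.
  have L0' : \sum_(y | e x y) (Gam e u u x - Gam e u u y) = 0.
    rewrite -[LHS]opprK -sumrN -[RHS]oppr0; congr (- _); rewrite -[RHS]L0.
    by apply: eq_bigr => z _; rewrite opprB.
  move/eqP: L0'; rewrite psumr_eq0 => [|z _]; last first.
    by rewrite subr_ge0 -(ler_pM2l (exprn_gt0 2 K_gt0)) xP poisson_Gam_le.
  by move/allP/(_ y (mem_index_enum _)); rewrite exy /= subr_eq0 => /eqP <-.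
split=> x; first by have [] := local x (all_max x).
have hc : forall y, h y = h x.
  move=> y; apply: (connected_const e_conn) => a b.
  by apply: Gam_eq0; have [] := local a (all_max a).
have: Lap e h x = 0 by rewrite /Lap big1 // => y _; rewrite !hc subrr.
by rewrite /h LapDZ uE => H; lra.
Qed.
End Gradient.

Section Diameter.
Variables (R : rcfType) (T : finType) (e : rel T).
Hypotheses (e_sym : symmetric e) (e_conn : forall x y, connect e x y).
Variables (K : R) (x0 : T).
Hypotheses (K_gt0 : 0 < K) (cd : CD e K).

Local Notation D := (maxdeg e).
Local Notation dist := (gdist e x0).
Local Notation f := (fun x => (dist x)%:R : R).

Lemma dist_sqr_le x y : e x y -> (f y - f x) * (f y - f x) <= 1.
Proof.
move=> exy; have := gdist_step e_conn x0 exy.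
have /(gdist_step e_conn x0) : e y x by rewrite e_sym.
rewrite -!(ler_nat R) -!natr1 => H1 H2.
have : 0 <= (1 - (f y - f x)) * (1 + (f y - f x)) by apply: mulr_ge0; lra.
by move=> H; lra.
Qed.

Lemma dist_Gam_le x : Gam e f f x <= D%:R / 2%:R.
Proof.
rewrite GamE ler_pM2r ?invr_gt0 ?ltr0n //.
apply: (@le_trans _ _ (\sum_(y | e x y) 1)); first by apply: ler_sum => y; apply: dist_sqr_le.
rewrite sumr_const ler_nat; exact: deg_le_maxdeg.
Qed.

Lemma far_pair_rigid y0 : f y0 = 2%:R * D%:R / K ->
  (forall x, Gam e f f x = D%:R / 2%:R) /\
  forall x, Lap e f x = - K * (f x - D%:R / K).
Proof.
move=> fy0; have [u [m uE]] := poisson_solvable e_sym e_conn f.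
have uG := poisson_Gam_le K_gt0 cd uE dist_Gam_le.
set r := D%:R / K in fy0 *.
have r0 : 0 <= r by rewrite divr_ge0 ?ler0n // ltW.
have DE : D%:R = r * K by rewrite divfK ?gt_eqF.
have cs x : (m - f x) ^+ 2 <= D%:R * (2%:R * Gam e u u x).
  rewrite -uE; apply: le_trans (sqr_sum_le _ _) _.
  rewrite GamE [2%:R * _]mulrC divfK ?pnatr_eq0 //.
  apply: ler_pM; rewrite ?ler0n ?ler_nat ?deg_le_maxdeg //.
  by apply: sumr_ge0 => y _; apply: sqr_ge0.
have cr x : (m - f x) ^+ 2 <= r ^+ 2.
  apply: le_trans (cs x) _; rewrite -(ler_pM2l (exprn_gt0 2 K_gt0)).
  have := uG x; rewrite -(ler_pM2l (_ : 0 < 2%:R)) ?ltr0n // => H.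
  have := ler_wpM2l (ler0n R D) H; rewrite DE; lra.
(* [f] is [0] at [x0] and [2 r] at [y0], and both values lie within [r] of [m]. *)
have mr : m = r.
  have := cr x0; have := cr y0; rewrite fy0 gdistxx subr0 -mulrA -/r.
  case: (ltrgtP m r) => // mr H1 H2.
    have : 0 < (r - m) * (3%:R * r - m) by apply: mulr_gt0; lra.
    by move=> H3; lra.
  have : 0 < (m - r) * (m + r) by apply: mulr_gt0; lra.
  by move=> H3; lra.
have [] := poisson_Gam_rigid e_conn K_gt0 cd uE dist_Gam_le (x1 := x0).
  apply/le_anti; rewrite uG /=.
  have := cs x0; rewrite gdistxx subr0 mr DE => H.
  have [rz|rz] := eqVneq r 0; first by rewrite rz mul0r mul0r mulr_ge0 ?sqr_ge0 ?Gam_ge0.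
  have rp : 0 < r by rewrite lt_def rz.
  have: 0 <= r * (2%:R * K * Gam e u u x0 - r) by lra.
  rewrite pmulr_rge0 // => H2.
  by have := mulr_ge0 (ltW K_gt0) H2; lra.
by rewrite mr.
Qed.
End Diameter.

(** * Distance shells *)

Section Shells.
Variables (R : rcfType) (T : finType) (e : rel T).
Hypotheses (e_sym : symmetric e) (e_irr : irreflexive e).
Hypothesis e_conn : forall x y, connect e x y.
Variables (K : R) (x0 x1 : T).
Hypotheses (K_gt0 : 0 < K) (cd : CD e K) (e01 : e x0 x1).

Local Notation D := (maxdeg e).
Local Notation dist := (gdist e x0).
Local Notation f := (fun x => (dist x)%:R : R).

Hypotheses (fG : forall x, Gam e f f x = D%:R / 2%:R)
           (fE : forall x, Lap e f x = - K * (f x - D%:R / K)).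

Let up x := [pred y | e x y & dist y == (dist x).+1].
Let dn x := [pred y | e x y & dist x == (dist y).+1].

(** [Gam f f x = D / 2] is half a sum of at most [D] terms, each at most [1]; so there are [D]
    terms, all equal to [1]. *)
Lemma shell_sqr x : (forall y, e x y -> (f y - f x) ^+ 2 = 1) /\ #|[pred y | e x y]| = D.
Proof.
have S0 : \sum_(y | e x y) (1 - (f y - f x) * (f y - f x)) = #|[pred y | e x y]|%:R - D%:R.
  rewrite sumrB sumr_const; congr (_ - _).
  have := fG x; rewrite GamE => /(congr1 (fun t => t * 2%:R)).
  by rewrite !divfK ?pnatr_eq0.
have ge0 y : e x y -> 0 <= 1 - (f y - f x) * (f y - f x).
  by move=> exy; rewrite subr_ge0 dist_sqr_le.
have dD : #|[pred y | e x y]| = D.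
  apply/eqP; rewrite eqn_leq deg_le_maxdeg -(ler_nat R) -subr_ge0 -S0.
  exact: sumr_ge0.
split=> // y exy; move: S0; rewrite dD subrr => /eqP; rewrite psumr_eq0 //.
by move/allP/(_ y (mem_index_enum _)); rewrite exy /= subr_eq0 -expr2 => /eqP.
Qed.

Lemma shell_deg x : #|[pred y | e x y]| = D.
Proof. by have [] := shell_sqr x. Qed.

Lemma shell_step x y : e x y -> dist y = (dist x).+1 \/ dist x = (dist y).+1.
Proof.
move=> exy; have [/(_ y exy) /eqP + _] := shell_sqr x.
rewrite sqrf_eq1 => /orP[]/eqP H; [left|right]; apply/eqP;
  rewrite -(eqr_nat R) -natr1; apply/eqP; lra.
Qed.

Lemma sum_shell (g : T -> R) x :
  \sum_(y | e x y) g y = \sum_(y in up x) g y + \sum_(y in dn x) g y.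
Proof.
rewrite (bigID (fun y => dist y == (dist x).+1)) /=; congr (_ + _).
apply: eq_bigl => y; rewrite inE; have [exy|//] := boolP (e x y).
by case: (shell_step exy) => ->; rewrite eqxx ltn_eqF.
Qed.

Lemma shell_counts x :
  #|up x|%:R + #|dn x|%:R = D%:R :> R /\ #|up x|%:R - #|dn x|%:R = D%:R - K * f x :> R.
Proof.
split.
  by rewrite -(shell_deg x) -!sumr_const -sum_shell.
transitivity (Lap e f x); last by rewrite fE mulrBr mulNr mulrCA mulNr divff ?gt_eqF //; ring.
rewrite /Lap sum_shell -!sumr_const -sumrN; congr (_ + _); apply: eq_bigr => y /andP[_ /eqP dE].
  by rewrite dE -natr1; ring.
by rewrite dE -natr1; ring.
Qed.

(** Only [x0] lies below [x1], so [shell_counts] reads [up + 1 = D] and [up - 1 = D - K]. *)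
Lemma shell_curvature : K = 2%:R.
Proof.
have dx1 : dist x1 = 1%N by case: (shell_step e01); rewrite gdistxx // => ->.
have dn1 : #|dn x1| = 1%N.
  rewrite (eq_card (B := pred1 x0)) ?card1 // => y; rewrite !inE dx1 eqSS eq_sym.
  apply/andP/eqP => [[_ /eqP]|->]; last by rewrite e_sym gdistxx.
  by move/(gdist_eq0 e_conn).
by have [] := shell_counts x1; rewrite dn1 dx1 => H1 H2; lra.
Qed.

Lemma card_dn x : #|dn x|%:R = f x.
Proof. by have [] := shell_counts x; rewrite shell_curvature => H1 H2; lra. Qed.

Lemma card_up x : #|up x|%:R = D%:R - f x.
Proof. by have [] := shell_counts x; rewrite card_dn => <- _; ring. Qed.

(* The raising and lowering operators between the shells thus satisfy the sl_2
   relation [dn up - up dn = D - 2 dist]. *)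
Lemma card_up_dn x y : x != y -> dist x = dist y ->
  #|[predI up x & up y]| = #|[predI dn x & dn y]|.
Proof.
move=> xy dxy; pose g x := f x - D%:R / K.
have gE z : Lap e g z = - K * g z.
  have := Lap_affine e f 1 (- (D%:R / K)) z; rewrite mul1r fE => <-.
  by apply: eq_Lap => w; rewrite mul1r.
have nexy : ~~ e x y by apply/negP => /shell_step; rewrite dxy; lia.
have := eigen_square e_sym cd gE xy nexy.
(* In the square rule a common neighbour counts [-2] in the upper shell and [2] in the lower one. *)
have -> : \sum_(z | e x z && e z y) (g x + g y - 2%:R * g z) =
   2%:R * \sum_(z | e x z) ((e z y)%:R * (f x - f z)).
  rewrite big_mkcondr mulr_sumr; apply: eq_bigr => z _ /=; rewrite /g dxy.
  by case: (e z y) => /=; ring.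
move/eqP; rewrite mulf_eq0 pnatr_eq0 /= sum_shell => H.
apply/eqP; rewrite -(eqr_nat R) -!sumr_const -subr_eq0 -oppr_eq0 opprB addrC.
rewrite -sumrN; apply: etrans H; congr (_ == 0); congr (_ + _).
  rewrite [LHS]big_mkcondr /=; apply: eq_bigr => z /andP[exz /eqP dz].
  rewrite inE /= e_sym -dxy dz eqxx andbT -natr1.
  by case: (e z y) => /=; ring.
rewrite [LHS]big_mkcondr /=; apply: eq_bigr => z /andP[exz /eqP dz].
rewrite inE /= e_sym -dxy dz eqxx andbT -natr1.
by case: (e z y) => /=; ring.
Qed.

(* On the hypercube with [x0] the empty set, [raise c #|A| A] is the sum of [c]
   over the elements of [A]. *)
Fixpoint raise (c : T -> R) (k : nat) (x : T) : R :=
  match k with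
  | 0 => 0
  | 1 => c x
  | k'.+1 => k'%:R^-1 * \sum_(y in dn x) raise c k' y
  end.

Section Raise.
Variable c : T -> R.
Let q x := raise c (dist x) x.
Let s := \sum_(y | e x0 y) c y.

Lemma raise_dn x : \sum_(y in dn x) q y = (f x - 1) * q x.
Proof.
have qd k : dist x = k.+1 -> \sum_(y in dn x) q y = \sum_(y in dn x) raise c k y.
  by move=> dx; apply: eq_bigr => y /andP[_]; rewrite dx eqSS /q => /eqP ->.
rewrite {2}/q; case dx: (dist x) => [|[|k]].
- rewrite mulr0 big_pred0 // => y; rewrite inE dx; exact: andbF.
- by rewrite subrr mul0r (qd _ dx) big1.
rewrite (qd _ dx) /= -natr1 addrK mulrA divff ?mul1r ?pnatr_eq0 //.
Qed.

(** Induction on the shell: [raise_dn] expands [q] on the upper shell as a downward sum,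
    [card_up_dn] trades up-then-down for down-then-up walks, and the induction hypothesis evaluates
    the upward sums one shell lower. *)
Lemma raise_up x : \sum_(y in up x) q y = (D%:R - 1 - f x) * q x + s.
Proof.
move: {2}(dist x) (erefl (dist x)) => k; elim: k x => [|k IH] x dx.
  have <- : x0 = x by apply: gdist_eq0 dx.
  rewrite {2}/q gdistxx mulr0 add0r /s sum_shell [X in _ = _ + X]big_pred0 => [|y]; last first.
    by rewrite inE gdistxx andbF.
  rewrite addr0; apply: eq_bigr => y /andP[_ /eqP].
  by rewrite gdistxx /q => ->.
have k0 : (k.+1)%:R != 0 :> R by rewrite pnatr_eq0.
apply: (mulfI k0).
transitivity (\sum_(z in up x) \sum_(y | e z y && (dist y == dist x)) q y).
  rewrite mulr_sumr; apply: eq_bigr => z /andP[_ /eqP dz].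
  transitivity (\sum_(y in dn z) q y).
    by rewrite raise_dn dz dx -[k.+2%:R]natr1 addrK.
  by apply: eq_bigl => y; rewrite inE dz eqSS eq_sym.
transitivity (\sum_(y | dist y == dist x) #|[predI up x & up y]|%:R * q y).
  rewrite (exchange_big_dep (fun y => dist y == dist x)) /=; last by move=> z y _ /andP[].
  apply: eq_bigr => y /eqP dy; rewrite mulr_natl -sumr_const.
  apply: eq_bigl => z; rewrite !inE /= dy eqxx andbT (e_sym z).
  by case: (e x z) => //=; case: (dist z == _); rewrite ?andbF ?andbT.
(* [card_up_dn] covers [y != x]; the diagonal term leaves the difference of the two degrees. *)
transitivity ((#|up x|%:R - #|dn x|%:R) * q x +
  \sum_(y | dist y == dist x) #|[predI dn x & dn y]|%:R * q y).
  rewrite (bigD1 x) //= [in RHS](bigD1 x) //=.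
  have E (P : pred T) : #|[predI P & P]| = #|P| by apply: eq_card => z; rewrite !inE andbb.
  rewrite !E addrA -mulrDl subrK; congr (_ + _); apply: eq_bigr => y /andP[/eqP dy yx].
  by rewrite card_up_dn // eq_sym.
transitivity ((#|up x|%:R - #|dn x|%:R) * q x + \sum_(w in dn x) \sum_(y in up w) q y).
  congr (_ + _).
  rewrite (exchange_big_dep (fun y => dist y == dist x)) /=; last first.
    by move=> w y /andP[_ /eqP ->] /andP[_ /eqP ->].
  apply: eq_bigr => y /eqP dy; rewrite mulr_natl -sumr_const.
  apply: eq_bigl => w; rewrite !inE /= dy (e_sym y) (eq_sym (dist x)).
  by case: (e x w) => //=; rewrite andbC.
rewrite (eq_bigr (fun w => (D%:R - f x) * q w + s)); last first.
  move=> w /andP[_]; rewrite dx eqSS => /eqP dw.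
  by rewrite IH // -dw -natr1; congr (_ * _ + _); ring.
rewrite big_split /= -mulr_sumr raise_dn sumr_const -(mulr_natl s) card_up card_dn dx.
by ring.
Qed.

(** The neighbours of [x] carry the total [(D - 2) q x + s]; the shift by [s / 2] absorbs the
    constant. *)
Lemma raise_eigen x : Lap e (fun y => q y - s / 2%:R) x = - 2%:R * (q x - s / 2%:R).
Proof.
transitivity (Lap e q x).
  by apply: eq_bigr => y _; ring.
rewrite /Lap sumrB sum_shell raise_up raise_dn sumr_const -(mulr_natl (q x)) shell_deg.
by field.
Qed.
End Raise.

Lemma shells_iso : iso_hypercube e D.
Proof.
have dD := esym (shell_deg x0).
pose nb (j : 'I_D) := enum_val (cast_ord dD j).
have nb_inj : injective nb by move=> i j /enum_val_inj /cast_ord_inj.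
have nb_adj j : e x0 (nb j) by have := enum_valP (cast_ord dD j); rewrite inE.
have nb_onto y : e x0 y -> exists j, y = nb j.
  move=> ey; have yN : y \in [pred y | e x0 y] by [].
  by exists (cast_ord (esym dD) (enum_rank_in yN y)); rewrite /nb cast_ordKV enum_rankK_in.
(* Indicator data on the first shell make the increments at [x0] the standard basis. *)
pose c i y : R := (y == nb i)%:R.
pose F i x := raise (c i) (dist x) x - (\sum_(y | e x0 y) c i y) / 2%:R.
apply: (@frame_iso R T e e_sym e_irr e_conn 2%:R D x0 nb F) => //.
- by rewrite -shell_curvature.
- by move=> x; rewrite shell_deg.
- move=> i x; exact: raise_eigen.
move=> i j; have d1 : dist (nb j) = 1%N.
  by case: (shell_step (nb_adj j)); rewrite gdistxx // => ->.
rewrite /F d1 gdistxx /= /c (inj_eq nb_inj) eq_sym; ring.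
Qed.
End Shells.

(** * Multiplicities of eigenvalues of symmetric matrices *)

Lemma char_poly_diagonalized (F : fieldType) n (P M : 'M[F]_n) (d : 'rV[F]_n) :
  P \in unitmx -> P *m M = diag_mx d *m P ->
  char_poly M = \prod_(x <- [seq d 0 i | i <- enum 'I_n]) ('X - x%:P).
Proof.
move=> uP PM; rewrite big_map big_enum /=.
have <- : char_poly (diag_mx d) = \prod_(i < n) ('X - (d 0 i)%:P).
  rewrite char_poly_trig ?diag_mx_is_trig //.
  by apply: eq_bigr => i _; rewrite mxE eqxx.
have : map_mx polyC P *m char_poly_mx M = char_poly_mx (diag_mx d) *m map_mx polyC P.
  rewrite /char_poly_mx mulmxBr mulmxBl -!map_mxM PM; congr (_ - _).
  by rewrite scalar_mxC.
move/(congr1 (fun A => \det A)); rewrite !det_mulmx mulrC => /mulIf; apply.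
by rewrite det_map_mx polyC_eq0 -unitfE -unitmxE.
Qed.

Section Symmetric.
Variable R : realFieldType.

Lemma mulmx_tr_eq0 m n (A : 'M[R]_(m, n)) : A *m A^T = 0 -> A = 0.
Proof.
move=> A0; apply/matrixP => i j; rewrite mxE.
have := congr1 (fun B : 'M_m => B i i) A0; rewrite !mxE => /eqP.
rewrite psumr_eq0 => [/allP/(_ j (mem_index_enum _))|k _]; last first.
  by rewrite mxE -expr2 sqr_ge0.
by rewrite mxE -expr2 sqrf_eq0 => /eqP.
Qed.

(** With an exponent that is a power of two, halving works: for [B = A^m] symmetric, [A^(2m) = 0]
    says [B B^T = 0], so [B = 0]. *)
Lemma sym_nilpotent_eq0 n (A : 'M[R]_n.+1) k : A^T = A -> A ^+ k = 0 -> A = 0.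
Proof.
move=> As Ak.
have {Ak} : A ^+ (2 ^ k) = 0.
  by rewrite -(subnK (ltnW (ltn_expl k (ltnSn 1)))) exprD Ak mulr0.
elim: k => [|k IH]; first by rewrite expr1.
rewrite expnS mulnC exprM => H; apply: IH; apply: mulmx_tr_eq0.
suff -> : (A ^+ (2 ^ k))^T = A ^+ (2 ^ k) by rewrite -[RHS]H expr2.
elim: (2 ^ k)%N => [|m IH]; first by rewrite trmx1.
by rewrite exprS trmx_mul IH As -[RHS]exprS exprSr.
Qed.

Lemma trmx_horner n (A : 'M[R]_n.+1) p : A^T = A -> (horner_mx A p)^T = horner_mx A p.
Proof.
move=> As; elim/poly_ind: p => [|p c IH]; first by rewrite rmorph0 trmx0.
rewrite rmorphD rmorphM /= horner_mx_X horner_mx_C linearD /= tr_scalar_mx.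
rewrite trmx_mul IH As; congr (_ + _).
exact: (comm_mx_horner p (comm_mx_refl A)).
Qed.

(** The squarefree part of the characteristic polynomial takes at [M] a symmetric value, nilpotent
    by Cayley-Hamilton, hence zero. So [M] is diagonalizable, and the rows of [P] for diagonal
    entries [a] are independent eigenvectors. *)
Lemma sym_mult_le_rank n (M : 'M[R]_n) (s : seq R) a :
  M^T = M -> char_poly M = \prod_(x <- s) ('X - x%:P) ->
  (count_mem a s <= \rank (eigenspace M a))%N.
Proof.
case: n M => [|n] M Ms Mchar.
  have := size_char_poly M; rewrite Mchar size_prod_XsubC => -[/size0nil ->].
  by [].
have [P uP /diagonalizable_forPex[d /(simmxLR uP) MP]] : diagonalizable M.
  apply/diagonalizableP; exists (undup s); first exact: undup_uniq.
  apply: mxminpoly_min; apply: (@sym_nilpotent_eq0 _ _ (size s)).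
    exact: trmx_horner.
  rewrite -rmorphXn /=.
  set p := \prod_(x <- _) _.
  have dvd t : {subset t <= s} -> \prod_(x <- t) ('X - x%:P) %| p ^+ size t.
    elim: t => [|x t IH] ts; first by rewrite big_nil dvd1p.
    rewrite big_cons exprS dvdp_mul ?IH //; last by move=> y yt; rewrite ts // inE yt orbT.
    by rewrite dvdp_XsubCl root_prod_XsubC mem_undup ts ?mem_head.
  have /dvdpP[q ->] : char_poly M %| p ^+ size s by rewrite Mchar dvd.
  by rewrite rmorphM /= Cayley_Hamilton mulr0.
have PM : P *m M = diag_mx d *m P by rewrite MP mxpoly.conjVmx // !mulmxA mulmxV // mul1mx.
have := char_poly_diagonalized uP PM; rewrite Mchar => /prod_XsubC_eq /permP ->.
pose I := [pred i | d 0 i == a].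
pose f (i : 'I_#|I|) : 'I_n.+1 := enum_val i.
have fP i : d 0 (f i) = a by apply/eqP; have := enum_valP i; rewrite inE.
have -> : count_mem a [seq d 0 i | i <- enum 'I_n.+1] = #|I|.
  by rewrite count_map cardE [enum I]/enum_mem size_filter enumT; apply: eq_count.
have <- : \rank (rowsub f P) = #|I|.
  rewrite rowsubE mxrankMfree ?row_free_unit //; apply/eqP/row_freeP.
  exists (rowsub f 1%:M)^T; rewrite -rowsubE; apply/matrixP => i j.
  by rewrite !mxE eq_sym (inj_eq enum_val_inj).
apply/mxrankS/eigenspaceP.
rewrite mul_rowsub_mx PM mul_diag_mx; apply/matrixP => i j.
by rewrite !mxE fP.
Qed.
End Symmetric.

(** * Eigenfunctions from the spectrum *)

Section Eigenvalue.
Variables (R : rcfType) (T : finType) (e : rel T).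
Hypotheses (e_sym : symmetric e) (e_irr : irreflexive e).
Hypothesis e_conn : forall x y, connect e x y.
Local Notation M := (negLapMx R e).
Local Notation D := (maxdeg e).

Definition vfun (v : 'rV[R]_#|T|) (x : T) : R := v 0 (enum_rank x).

Lemma vfun_inj v w : (forall x, vfun v x = vfun w x) -> v = w.
Proof.
by move=> vw; apply/rowP => i; have := vw (enum_val i); rewrite /vfun enum_valK.
Qed.

Lemma negLapMx_sym : M^T = M.
Proof.
apply/matrixP => i j; rewrite !mxE eq_sym e_sym.
by case: eqP => // ->.
Qed.

Lemma vfun_negLap v x : vfun (v *m M) x = - Lap e (vfun v) x.
Proof.
rewrite /vfun mxE (reindex (@enum_rank T)) /=; last exact: onW_bij (enum_rank_bij T).
rewrite /Lap sumrB sumr_const opprB.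
rewrite (bigD1 x) //= mxE eqxx enum_rankK mulr_natr; congr (_ + _).
rewrite [X in - X]big_mkcond [X in - X](bigD1 x) //= e_irr add0r -sumrN.
apply: eq_bigr => y yx; rewrite !mxE (inj_eq enum_rank_inj) (negbTE yx) !enum_rankK e_sym.
by case: (e x y); rewrite ?mulrN1 ?mulr0 ?oppr0.
Qed.

Lemma eigenspaceE (v : 'rV[R]_#|T|) a :
  (v <= eigenspace M a)%MS <-> forall x, Lap e (vfun v) x = - a * vfun v x.
Proof.
have E x : vfun (a *: v) x = a * vfun v x by rewrite /vfun mxE.
split=> [/eigenspaceP vM x|H]; first by rewrite mulNr -E -vM vfun_negLap opprK.
by apply/eigenspaceP/vfun_inj => x; rewrite E vfun_negLap H mulNr opprK.
Qed.

Lemma eigen_const_eq0 (v : 'rV[R]_#|T|) a : a != 0 -> (v <= eigenspace M a)%MS ->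
  (forall x y, vfun v x = vfun v y) -> v = 0.
Proof.
move=> a0 /eigenspaceE vE vc; apply: vfun_inj => x.
have := vE x; rewrite /Lap big1 => [/esym/eqP|y _]; last by rewrite (vc y x) subrr.
by rewrite mulf_eq0 oppr_eq0 (negbTE a0) /= => /eqP ->; rewrite /vfun mxE.
Qed.

Lemma rank_eigenspace0 : (\rank (eigenspace M 0) <= 1)%N.
Proof.
apply: leq_trans (rank_leq_row (const_mx 1 : 'rV[R]_#|T|)); apply/mxrankS/rV_subP => v.
move=> /eigenspaceE vE.
have vc : forall x y, vfun v x = vfun v y.
  by apply: (Lap0_const e_sym e_conn) => x; rewrite vE oppr0 mul0r.
case: (pickP (@predT T)) => [x0 _|T0].
  suff -> : v = vfun v x0 *: const_mx 1 by apply: scalemx_sub.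
  by apply: vfun_inj => x; rewrite [RHS]mxE mxE mulr1.
suff -> : v = 0 by apply: sub0mx.
by apply: vfun_inj => x; have := T0 x.
Qed.

Variable K : R.
Hypotheses (K_gt0 : 0 < K) (cd : CD e K).

Lemma spectrum_gap (s : seq R) a : spectrum e s -> a \in s -> a = 0 \/ K <= a.
Proof.
move=> [_ sP] sa; have [->|a0] := eqVneq a 0; [by left|right].
have /eigenvalueP[v vM v0] : eigenvalue M a.
  by rewrite eigenvalue_root_char sP root_prod_XsubC.
have vE : (v <= eigenspace M a)%MS by apply/eigenspaceP.
have [vc|//] := lichnerowicz e_sym e_conn cd ((eigenspaceE v a).1 vE).
by rewrite (eigen_const_eq0 a0 vE vc) eqxx in v0.
Qed.

(** By the gap and sortedness the first [k + 1] entries are [0] or [K], and at most one is [0]. *)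
Lemma rank_eigenspace_ge k : eigval_eq e k K -> (k <= \rank (eigenspace M K))%N.
Proof.
move=> [s [sP sK]]; have [srt sM] := sP.
(* Past the end [nth] returns the default [0], which differs from [K]. *)
have k_lt : (k < size s)%N.
  by rewrite ltnNge; apply: contraL K_gt0 => ks; rewrite -sK nth_default ?ltxx.
have c0 := sym_mult_le_rank 0 negLapMx_sym sM.
have cK := sym_mult_le_rank K negLapMx_sym sM.
apply: leq_trans cK; rewrite -ltnS -[k.+1](size_takel k_lt) -(count_predC (pred1 K)).
rewrite -[leqRHS]addn1; apply: leq_add.
  by rewrite -[in leqRHS](cat_take_drop k.+1 s) count_cat leq_addr.
apply: leq_trans rank_eigenspace0; apply: leq_trans c0.
rewrite (@eq_in_count _ _ (pred1 0) (take k.+1 s)).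
  by rewrite -[in leqRHS](cat_take_drop k.+1 s) count_cat leq_addr.
move=> a at_ /=.
have as_ : a \in s := mem_take at_.
have [->|Ka] := spectrum_gap sP as_; first by rewrite eqxx eq_sym gt_eqF.
have /nthP - /(_ 0)[i] := at_; rewrite size_takel // => ik ai.
rewrite nth_take // in ai.
have : a <= K.
  rewrite -ai -sK; apply: (sorted_leq_nth le_trans le_refl) => //; rewrite inE //.
  exact: leq_trans ik k_lt.
move=> aK; have -> : a = K by apply/le_anti; rewrite aK.
by rewrite eqxx gt_eqF.
Qed.

(** An eigenfunction with zero gradient at [x0] has [Gam] zero everywhere, so it vanishes. Hence the
    gradient at [x0] embeds the eigenspace, of dimension at least [D], into a space of dimension
    [deg x0 <= D]; the preimage of the standard basis is the frame. *)
Lemma eigval_frame x0 : eigval_eq e D K ->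
  exists nb : 'I_D -> T, exists F : 'I_D -> T -> R,
  [/\ forall j, e x0 (nb j), forall y, e x0 y -> exists j, y = nb j,
      forall i x, Lap e (F i) x = - K * F i x
    & forall i j, F i (nb j) - F i x0 = (i == j)%:R].
Proof.
move/rank_eigenspace_ge => rD.
pose N := [pred y | e x0 y]; pose y_ (k : 'I_#|N|) : T := enum_val k.
(* Right multiplication by [G] takes the gradient at [x0]. *)
pose G : 'M[R]_(#|T|, #|N|) := \matrix_(i, k)
  ((enum_val i == y_ k)%:R - (enum_val i == x0)%:R).
have GE m (W : 'M_(m, _)) i k : (W *m G) i k = vfun (row i W) (y_ k) - vfun (row i W) x0.
  have E x : \sum_j W i j * (enum_val j == x)%:R = vfun (row i W) x.
    rewrite (bigD1 (enum_rank x)) //= enum_rankK eqxx mulr1 big1 ?addr0.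
      by rewrite /vfun mxE.
    by move=> j jx; rewrite -[enum_val j == x](inj_eq enum_rank_inj) enum_valK (negbTE jx) mulr0.
  rewrite mxE -!E -sumrB; apply: eq_bigr => j _; rewrite mxE; ring.
pose E := row_base (eigenspace M K).
have EG_free : row_free (E *m G).
  rewrite -kermx_eq0 -submx0; apply/rV_subP => w /sub_kermxP.
  rewrite mulmxA => wEG.
  have wE : (w *m E <= eigenspace M K)%MS by rewrite mulmx_sub // eq_row_base.
  have fE := (eigenspaceE _ _).1 wE; set f := vfun _ in fE.
  have G0 : Gam e f f x0 = 0.
    rewrite GamE big1 ?mul0r // => y ey.
    have yN : y \in N by [].
    have := GE _ (w *m E) 0 (enum_rank_in yN y).
    rewrite wEG mxE /y_ enum_rankK_in // (_ : row 0 _ = w *m E); last first.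
      by apply/rowP => j; rewrite mxE.
    by move=> <-; rewrite mul0r.
  have fc : forall x y, f x = f y.
    apply: (connected_const e_conn) => x; apply: Gam_eq0.
    by rewrite (eigen_Gam_const e_sym e_conn cd fE x x0).
  have /eqP := eigen_const_eq0 (lt0r_neq0 K_gt0) wE fc.
  by rewrite mulmx_free_eq0 ?row_base_free // submx0.
have rN : (\rank (eigenspace M K) <= #|N|)%N.
  by rewrite -(eqP EG_free) rank_leq_col.
have ND : D = #|N|.
  by apply/eqP; rewrite eqn_leq deg_le_maxdeg (leq_trans rD rN).
have /row_fullP[X XEG] : row_full (E *m G).
  by rewrite /row_full (eqP EG_free) eqn_leq rN -ND rD.
exists (fun j => y_ (cast_ord ND j)), (fun i => vfun (row (cast_ord ND i) (X *m E))).
split.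
- by move=> j; have := enum_valP (cast_ord ND j).
- move=> y ey; have yN : y \in N by [].
  by exists (cast_ord (esym ND) (enum_rank_in yN y)); rewrite cast_ordKV /y_ enum_rankK_in.
- move=> i; apply/eigenspaceE; rewrite row_mul mulmx_sub ?eq_row_base //.
by move=> i j; rewrite -GE -mulmxA XEG mxE (inj_eq (@cast_ord_inj _ _ ND)).
Qed.
End Eigenvalue.

(** * The hypercube *)

Section Hypercube.
Variables (R : rcfType) (T : finType) (e : rel T) (D : nat).
Variables (f : T -> {set 'I_D}) (g : {set 'I_D} -> T).
Hypotheses (fK : cancel f g) (gK : cancel g f).
Hypothesis ef : forall x y, e x y = hc_adj (f x) (f y).

Let s i x := g (flip i (f x)).

Lemma cube_stepP x y : reflect (exists i, y = s i x) (e x y).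
Proof.
rewrite ef; apply: (iffP (hc_adjP _ _)) => -[i iP]; exists i.
  by rewrite /s -iP fK.
by rewrite iP gK.
Qed.

Lemma cube_sum (h : T -> R) x : \sum_(y | e x y) h y = \sum_i h (s i x).
Proof.
have s_inj : injective (s^~ x).
  move=> i j /(can_inj gK)/setP/(_ i); rewrite !in_flip eqxx.
  by case: eqP => // _; case: (_ \in _).
rewrite (eq_bigl (mem (codom (s^~ x)))); last first.
  by move=> y; apply/cube_stepP/codomP.
rewrite -big_uniq /=; last by rewrite /codom /image_mem map_inj_uniq ?enum_uniq.
by rewrite big_image.
Qed.

Lemma cube_Lap (h : T -> R) x : Lap e h x = \sum_i (h (s i x) - h x).
Proof. by rewrite /Lap cube_sum. Qed.

Lemma cube_Gam (h k : T -> R) x :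
  Gam e h k x = (\sum_i (h (s i x) - h x) * (k (s i x) - k x)) / 2%:R.
Proof. by rewrite GamE cube_sum. Qed.

(** A Bochner formula: commuting flips bring both parts of [Gam2] to the same second differences,
    and [a^2 - b^2 - 2 b (a - b) = (a - b)^2]. *)
Lemma cube_Gam2 (h : T -> R) x :
  Gam2 e h h x =
  (\sum_i \sum_j (h (s i (s j x)) - h (s j x) - (h (s i x) - h x)) ^+ 2) / 4%:R.
Proof.
have sC i j y : s i (s j y) = s j (s i y).
  by rewrite /s !gK; congr g; apply/setP => k; rewrite !in_flip addbAC.
have LG : Lap e (Gam e h h) x = (\sum_i \sum_j ((h (s i (s j x)) - h (s j x)) ^+ 2
    - (h (s i x) - h x) ^+ 2)) / 2%:R.
  rewrite cube_Lap exchange_big /= mulr_suml; apply: eq_bigr => j _.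
  by rewrite !cube_Gam -mulrBl -sumrB; congr (_ / _); apply: eq_bigr => i _; ring.
have GL : Gam e h (Lap e h) x = (\sum_i \sum_j (h (s i x) - h x) *
    (h (s i (s j x)) - h (s j x) - (h (s i x) - h x))) / 2%:R.
  rewrite cube_Gam; congr (_ / _); apply: eq_bigr => i _.
  rewrite !cube_Lap -sumrB mulr_sumr; apply: eq_bigr => j _.
  by rewrite (sC i j); ring.
rewrite Gam2_diag LG GL; set A := \sum_i _; set B := \sum_i _; set C := \sum_i _.
have -> : C = A - 2%:R * B.
  rewrite /A /B /C mulr_sumr -sumrB; apply: eq_bigr => i _.
  rewrite mulr_sumr -sumrB; apply: eq_bigr => j _; ring.
by field.
Qed.

(** Only the terms [i = j] are kept: there [s i (s i x) = x] makes the second difference [-2] times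
    the first. *)
Lemma cube_CD : CD e (2%:R : R).
Proof.
move=> h x; have sK i : s i (s i x) = x by rewrite /s gK flipK fK.
rewrite cube_Gam cube_Gam2; set A := \sum_i _; set B := \sum_i _.
suff: 4%:R * B <= A by move=> H; lra.
rewrite /A /B mulr_sumr; apply: ler_sum => i _.
rewrite (bigD1 i) //= sK.
apply: le_trans (_ : _ <= (h x - h (s i x) - (h (s i x) - h x)) ^+ 2) _.
  by rewrite le_eqVlt; apply/orP; left; apply/eqP; ring.
by rewrite lerDl; apply: sumr_ge0 => j _; apply: sqr_ge0.
Qed.

(** The Walsh functions, that is, the characters of [(Z/2)^D]. *)
Definition chi (S A : {set 'I_D}) : R := \prod_(i in S) (-1) ^+ (i \in A).

Lemma chi_flip S A k : chi S (flip k A) = (-1) ^+ (k \in S) * chi S A.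
Proof.
have E (B : {set 'I_D}) : \prod_(i in B | i != k) (-1) ^+ (i \in flip k A) =
    \prod_(i in B | i != k) (-1) ^+ (i \in A) :> R.
  by apply: eq_bigr => i /andP[_ /negbTE ik]; rewrite in_flip ik addbF.
rewrite /chi; have [kS|kS] := boolP (k \in S).
  by rewrite (bigD1 k) //= [in RHS](bigD1 k) //= E in_flip eqxx addbT signrN; ring.
rewrite expr0 mul1r; apply: eq_bigr => i iS; rewrite in_flip.
by case: eqP => [ik|_]; [rewrite -ik iS in kS | rewrite addbF].
Qed.

Lemma chi_sqr S A : chi S A * chi S A = 1.
Proof.
by rewrite /chi -big_split /= big1 // => i _; rewrite -signr_addb addbb.
Qed.

(** Flipping a coordinate that lies in exactly one of [S] and [S'] negates the product. *)
Lemma chi_orth S S' : S != S' -> \sum_A chi S A * chi S' A = 0.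
Proof.
move=> SS'; have [k kP] : exists k, (k \in S) != (k \in S').
  apply/existsP; rewrite -negb_forall; apply: contra SS' => /forallP H.
  by apply/eqP/setP => k; apply/eqP; apply: H.
set X := \sum_A _; suff: X = - X by move=> H; lra.
rewrite {1}/X (reindex_inj (inv_inj (@flipK _ k))) /= /X -sumrN; apply: eq_bigr => A _.
rewrite !chi_flip; move: kP.
by case: (k \in S); case: (k \in S') => // _; rewrite expr0 expr1; ring.
Qed.

(** The character table diagonalizes the Laplacian: flipping [k] changes [chi S] by the factor [-1]
    if [k] is in [S] and fixes it otherwise. *)
Lemma cube_char_poly :
  char_poly (negLapMx R e) =
  \prod_(A : {set 'I_D}) ('X - (2%:R * #|A|%:R)%:P).
Proof.
have e_sym : symmetric e.
  move=> x y; apply/cube_stepP/cube_stepP => -[i ->]; exists i; by rewrite /s gK flipK fK.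
have e_irr : irreflexive e.
  move=> x; apply/cube_stepP => -[i] /(congr1 f)/setP/(_ i).
  by rewrite /s gK in_flip eqxx addbT; case: (_ \in _).
pose S i := f (@enum_val T predT i).
have S_bij : bijective S.
  exists (fun A => enum_rank (g A)) => [i|A]; first by rewrite /S fK enum_valK.
  by rewrite /S enum_rankK gK.
pose P : 'M[R]_#|T| := \matrix_(i, j) chi (S i) (S j).
pose d : 'rV[R]_#|T| := \row_i (2%:R * #|S i|%:R).
have -> : \prod_(A : {set 'I_D}) ('X - (2%:R * #|A|%:R)%:P) =
   \prod_(x <- [seq d 0 i | i <- enum 'I_#|T|]) ('X - x%:P) :> {poly R}.
  rewrite big_map big_enum /= (reindex S); last exact: onW_bij.
  by apply: eq_bigr => i _; rewrite mxE.
apply: (@char_poly_diagonalized _ _ P).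
  have PP : P *m P^T = (#|{set 'I_D}|%:R)%:M.
    apply/matrixP => i j; rewrite !mxE.
    transitivity (\sum_A chi (S i) A * chi (S j) A).
      rewrite [RHS](reindex S); last exact: onW_bij.
      by apply: eq_bigr => k _; rewrite !mxE.
    have [->|ij] := eqVneq i j; last by rewrite chi_orth // (inj_eq (bij_inj S_bij)).
    under eq_bigr do rewrite chi_sqr.
    by rewrite sumr_const mulr1n.
  have : P *m P^T \in unitmx.
    rewrite PP unitmxE det_scalar unitrX // unitfE pnatr_eq0 -lt0n.
    by apply/card_gt0P; exists set0.
  by rewrite unitmx_mul => /andP[].
apply/row_matrixP => i; rewrite row_mul.
apply: vfun_inj => x; rewrite vfun_negLap // cube_Lap.
have E y : vfun (row i P) y = chi (S i) (f y) by rewrite /vfun !mxE /S enum_rankK.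
have -> : vfun (row i (diag_mx d *m P)) x = 2%:R * #|S i|%:R * chi (S i) (f x).
  by rewrite mul_diag_mx /vfun !mxE /S enum_rankK.
rewrite (bigID (mem (S i))) /= [X in _ + X]big1 ?addr0 => [|k /negbTE kS]; last first.
  by rewrite !E /s gK chi_flip kS expr0 mul1r subrr.
rewrite (eq_bigr (fun=> - (2%:R * chi (S i) (f x)))) => [|k kS]; last first.
  by rewrite !E /s gK chi_flip kS expr1; ring.
by rewrite sumrN opprK sumr_const -mulr_natr; ring.
Qed.

Lemma cube_eigval : (0 < D)%N -> eigval_eq e D (2%:R : R).
Proof.
move=> D_gt0; pose t : seq R := [seq 2%:R * #|A|%:R | A : {set 'I_D}].
exists (sort <=%R t); split; first split.
- by apply: sort_sorted; apply: le_total.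
- rewrite cube_char_poly (perm_big t) /=; last by rewrite perm_sort.
  by rewrite big_map big_enum.
have cnt (p : pred R) : count p (sort <=%R t) = #|[set A : {set 'I_D} | p (2%:R * #|A|%:R)]|.
  rewrite (permP (permEl (perm_sort _ _))) count_map cardE.
  rewrite [enum [set _ | _]]/enum_mem size_filter enumT.
  by apply: eq_count => A; rewrite /= inE.
have two n : 2%:R * n%:R = (2 * n)%:R :> R by rewrite natrM.
(* Only the empty set gives an entry below [2]; with the [D] singletons there are [D + 1] entries at
   most [2]. As [0 < D], index [D] falls between these counts. *)
apply: nth_count_eq; first by apply: sort_sorted; apply: le_total.
rewrite !cnt; apply/andP; split.
  apply: leq_trans (_ : #|[set (set0 : {set 'I_D})]| <= _)%N; last by rewrite cards1.
  apply: subset_leq_card; apply/subsetP => A; rewrite !inE two ltr_nat -cards_eq0.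
  by lia.
apply: leq_trans (_ : #|[set A : {set 'I_D} | #|A| == 1%N] :|: [set set0]| <= _)%N.
  rewrite cardsU cards1 card_draws card_ord bin1 disjoint_setI0 ?cards0 ?subn0 ?addn1 //.
  by rewrite disjoint_sym disjoints1 inE cards0.
apply: subset_leq_card; apply/subsetP => A; rewrite !inE two ler_nat.
by case/orP => /eqP ->; rewrite ?cards0.
Qed.

Definition symdiff (A B : {set 'I_D}) : {set 'I_D} := [set i | (i \in A) (+) (i \in B)].

Lemma symdiff_flip A B k : symdiff A (flip k B) = flip k (symdiff A B).
Proof. by apply/setP => i; rewrite !inE addbA. Qed.

Lemma card_flip_le k (A : {set 'I_D}) : (#|flip k A| <= #|A|.+1)%N.
Proof.
apply: leq_trans (_ : #|k |: A| <= _)%N; last by rewrite cardsU1 -add1n leq_add2r leq_b1.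
by apply/subset_leq_card/subsetP => i; rewrite !inE; case: eqP; rewrite ?addbF.
Qed.

Lemma card_flip_in k (A : {set 'I_D}) : k \in A -> #|A| = #|flip k A|.+1.
Proof.
move=> kA; rewrite (cardsD1 k) kA add1n; congr _.+1; apply: eq_card => i; rewrite !inE.
by case: eqP => [->|_]; rewrite ?kA ?addbF.
Qed.

Lemma cube_path x p : path e x p -> (#|symdiff (f x) (f (last x p))| <= size p)%N.
Proof.
elim/last_ind: p => [|p y IH].
  by rewrite leqn0 cards_eq0 => _; apply/eqP/setP => i; rewrite !inE addbb.
rewrite rcons_path last_rcons size_rcons => /andP[/IH pp /cube_stepP[i ->]].
by rewrite /s gK symdiff_flip (leq_trans (card_flip_le _ _)).
Qed.

(** Flipping a differing coordinate brings two vertices closer, which bounds distances by [D]; the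
    empty and the full set attain the bound by [cube_path]. *)
Lemma cube_diam : (forall x y, connect e x y) -> diam e = D.
Proof.
move=> e_conn; apply/eqP; rewrite eqn_leq; apply/andP; split.
  apply/bigmax_leqP => x _; apply/bigmax_leqP => y _.
  suff H n z : #|symdiff (f x) (f z)| = n -> (gdist e x z <= n)%N.
    by apply: leq_trans (H _ _ erefl) _; rewrite -[leqRHS]card_ord max_card.
  elim: n z => [|n IH] z.
    move/eqP; rewrite cards_eq0 => /eqP/setP xz.
    suff -> : z = x by rewrite gdistxx.
    apply: (can_inj fK); apply/setP => i; have := xz i; rewrite !inE.
    by case: (_ \in _); case: (_ \in _).
  move=> dz; have /card_gt0P[k kxz] : (0 < #|symdiff (f x) (f z)|)%N by rewrite dz.
  have e_zz : e (s k z) z by apply/cube_stepP; exists k; rewrite /s gK flipK fK.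
  apply: leq_trans (gdist_step e_conn x e_zz) _; rewrite ltnS; apply: IH.
  by apply: succn_inj; rewrite -dz (card_flip_in kxz) /s gK symdiff_flip.
have /walkP[p [sp pp lp]] := gdist_walk e_conn (g set0) (g setT).
apply: leq_trans (leq_trans (cube_path pp) _).
  rewrite lp !gK -[leqLHS]card_ord; apply: subset_leq_card; apply/subsetP => i _.
  by rewrite !inE.
rewrite sp; apply: leq_trans (leq_bigmax (g set0)).
exact: (@leq_bigmax _ (gdist e (g set0))).
Qed.

End Hypercube.

(** * The equivalence *)

Lemma connected_edge (T : finType) (e : rel T) :
  (forall x y, connect e x y) -> (1 < #|T|)%N -> forall x, exists y, e x y.
Proof.
move=> e_conn /card_gt1P[a [b [_ _ ab]]] x.
have [w wx] : exists w, w != x.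
  by have [ax|] := eqVneq a x; [exists b; rewrite -ax eq_sym | exists a].
have /connectP[[|y p] /= pP wE] := e_conn x w; first by rewrite wE eqxx in wx.
by exists y; case/andP: pP.
Qed.

Lemma eigval_iso (R : rcfType) (T : finType) (e : rel T) (K : R) :
  symmetric e -> irreflexive e -> (forall x y, connect e x y) -> (0 < #|T|)%N ->
  0 < K -> CD e K -> eigval_eq e (maxdeg e) K -> iso_hypercube e (maxdeg e).
Proof.
move=> e_sym e_irr e_conn /card_gt0P[x0 _] K_gt0 cd eK.
have [nb [F [nb_adj nb_onto F_eigen F_nb]]] :=
  eigval_frame e_sym e_irr e_conn K_gt0 cd x0 eK.
exact: (frame_iso e_sym e_irr e_conn cd (deg_le_maxdeg e) nb_adj nb_onto F_eigen F_nb).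
Qed.

Lemma diam_iso (R : rcfType) (T : finType) (e : rel T) (K : R) :
  symmetric e -> irreflexive e -> (forall x y, connect e x y) -> (1 < #|T|)%N ->
  0 < K -> CD e K -> (diam e)%:R = 2%:R * (maxdeg e)%:R / K ->
  iso_hypercube e (maxdeg e).
Proof.
move=> e_sym e_irr e_conn T_big K_gt0 cd dK.
have /card_gt0P[z _] := ltnW T_big.
have [x0 [y0 d0]] := diam_attained e z.
rewrite -d0 in dK; have [fG fE] := far_pair_rigid e_sym e_conn K_gt0 cd dK.
have [x1 e01] := connected_edge e_conn T_big x0.
exact: (shells_iso e_sym e_irr e_conn K_gt0 cd e01 fG fE).
Qed.

Theorem theorem1 (R : rcfType) (T : finType) (e : rel T)
  (e_sym : symmetric e) (e_irr : irreflexive e)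
  (e_conn : forall x y : T, connect e x y) (T_big : (1 < #|T|)%N) :
  [<-> iso_hypercube e (maxdeg e);
       exists K : R, 0 < K /\ CD e K /\ eigval_eq e (maxdeg e) K;
       exists K : R, 0 < K /\ CD e K /\ (diam e)%:R = 2%:R * (maxdeg e)%:R / K].
Proof.
tfae.
- move=> [f [[g fK gK] ef]]; exists 2%:R; split; first exact: ltr0n.
  split; first exact: (cube_CD fK gK ef).
  apply: (cube_eigval R fK gK ef).
  have /card_gt0P[x _] := ltnW T_big.
  have [y exy] := connected_edge e_conn T_big x.
  apply: leq_trans (deg_le_maxdeg e x).
  by apply/card_gt0P; exists y.
(* This implication passes through the hypercube, with the constant [2] as new witness. *)
- move=> [K [K_gt0 [cd eK]]].
  have [f [[g fK gK] ef]] := eigval_iso e_sym e_irr e_conn (ltnW T_big) K_gt0 cd eK.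
  exists 2%:R; split; first exact: ltr0n.
  split; first exact: (cube_CD fK gK ef).
  by rewrite (cube_diam fK gK ef e_conn) mulrC mulKf ?pnatr_eq0.
- by move=> [K [K_gt0 [cd dK]]]; apply: (diam_iso e_sym e_irr e_conn T_big K_gt0 cd dK).
Qed.
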